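(* Let $G$ be any graph. The following hold up to $\mathscr C$-equivalence: (i) $\mathscr C^\Gamma$ is the least $\mathscr C$-system of $G$ with respect to $\le_{\mathscr C}$, i.e. $\mathscr C^\Gamma\le_{\mathscr C}\mathscr C^\alpha$ for every $\mathscr C$-system $\mathscr C^\alpha$ of $G$. (ii) $\mathscr C^{\mathcal U}$ is the greatest $\mathscr C$-system of $G$ with respect to $\le_{\mathscr C}$, i.e. $\mathscr C^\alpha\le_{\mathscr C}\mathscr C^{\mathcal U}$ for every $\mathscr C$-system $\mathscr C^\alpha$ of $G$. Moreover, the following hold up to topological equivalence: (iii) $|G|_\Gamma$ is the coarsest $\mathscr C$-compactification of $G$. (iv) $|G|_\Theta$ is the finest $\mathscr C$-compactification of $G$. Therefore $|G|_\Gamma$ is a quotient of every $\mathscr C$-compactification of $G$, which in turn is always a quotient of $|G|_\Theta$. (Here $\alpha G$ is a quotient of $\delta G$ if there is $f\colon\delta G\ge\alpha G$ and $\alpha G$ is topologically equivalent to $\delta G/\{f^{-1}(\xi)\mid\xi\in\alpha G\}$.) In particular, $|G|_\Gamma$ and $|G|_\Theta/{\sim}$ are topologically equivalent.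
   Context: Graph notation. $G=(V,E)$ is a graph, $\mathcal X$ is the set of all finite subsets of $V$, directed by inclusion; for $X\in\mathcal X$, $\mathcal C_X$ is the set of components of $G-X$, with the discrete topology; for $Y\subseteq X$, $\mathcal C_X(Y)=\{C\in\mathcal C_X\mid N(C)=Y\}$; for $X\subseteq X'$, $\mathfrak c_{X',X}\colon\mathcal C_{X'}\to\mathcal C_X$ sends each component of $G-X'$ to the component of $G-X$ including it. $V[\mathcal C]=\bigcup_{C\in\mathcal C}V(C)$. $X\in\mathcal X$ is critical if $\mathcal C_X(X)$ is infinite; $\mathrm{crit}(G)$ is the set of critical sets, $\mathrm{crit}(X)$ the set of critical subsets of $X$. For $Y\in\mathrm{crit}(G)$ with $Y\not\subseteq X$, $C_X(Y)$ is the unique component of $G-X$ meeting $Y$. A ray is a 1-way infinite path; two rays are equivalent if for every $X\in\mathcal X$ both have a tail in the same component of $G-X$; ends are equivalence classes of rays, $\Omega$ is the set of ends, $C(X,\omega)$ is the component of $G-X$ in which the rays of $\omega$ have a tail; $\omega$ is identified with $(C(X,\omega)\mid X\in\mathcal X)$, so $\Omega=\varprojlim\mathcal C_X$ (known, Diestel and Kühn). Topology. $G$ also denotes its 1-complex, with point set $V\sqcup\bigsqcup_{e\in E}\mathring e$, where each edge $e=xy$ is a homeomorphic copy $\{x\}\sqcup\mathring e\sqcup\{y\}$ of $[0,1]$ with $\mathring e$ corresponding to $(0,1)$; basic open neighbourhoods of points of $\mathring e$ are inherited from $(0,1)$, and those of a vertex $v$ are the unions $\bigcup_{e\ni v}[v,i_e)$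 of half-open intervals with $i_e\in\mathring e$ arbitrary. For $F\subseteq E$, $\mathring F=\bigsqcup_{e\in F}\mathring e$; $E(X,\bigcup\mathcal C)$ is the set of edges between $X$ and $\bigcup\mathcal C$. $|G|_\Omega=G\sqcup\Omega$ has the topology generated by the open sets of $G$ and all sets $\bigcup\mathcal C\cup\mathring E(X,\bigcup\mathcal C)\cup\{\omega\in\Omega\mid C(X,\omega)\in\mathcal C\}$ with $X\in\mathcal X$, $\mathcal C\subseteq\mathcal C_X$. Compactifications. A compactification of a space $Y$ is a pair $(K,h)$ with $K$ compact (not necessarily Hausdorff) and $h\colon Y\to K$ an embedding with dense image. $(K,h)\le(K',h')$ ($(K,h)$ coarser, $(K',h')$ finer) if there is a continuous $f\colon K'\to K$ with $f\circ h'=h$; one writes $f\colon(K',h')\ge(K,h)$. They are topologically equivalent if some such $f$ is a homeomorphism. An $\Omega$-compactification of $G$ is a compactification $\alpha G$ of $|G|_\Omega$ such that $\alpha G\setminus\mathring E$ is a Hausdorff compactification of $|G|_\Omega\setminus\mathring E$; $\Omega$-compactifications are compared as compactifications of $|G|_\Omega$. Coarsest (finest) in a class means $\le$ ($\ge$) every member of the class. $\mathscr C$-systems. A $\mathscr C$-system of $G$ is an inverse system $\mathscr C^\alpha=\{(\alpha(\mathcal C_X),\alpha_X),\mathfrak a_{X',X},\mathcal X\}$ of Hausdorff compactifications of the discrete spaces $\mathcal C_X$, with continuous compatible bonding maps $\mathfrak a_{X',X}\colon\alpha(\mathcal C_{X'})\to\alpha(\mathcal C_X)$ satisfying $\mathfrak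 a_{X',X}\circ\alpha_{X'}=\alpha_X\circ\mathfrak c_{X',X}$ for all $X\subseteq X'$. Let $\mathcal I^\alpha=\varprojlim\alpha(\mathcal C_X)$, $\pi_X^\alpha\colon\mathcal I^\alpha\to\alpha(\mathcal C_X)$ the projections, and $\iota^\alpha\colon\Omega\hookrightarrow\mathcal I^\alpha$, $(C_X)_X\mapsto(\alpha_X(C_X))_X$. $\alpha G=G\sqcup\mathcal I^\alpha$ carries the topology generated by the open sets of $G$ and, for all $X\in\mathcal X$ and open $O\subseteq\alpha(\mathcal C_X)$, the sets $\bigcup\mathcal C\cup\mathring E(X,\bigcup\mathcal C)\cup(\pi_X^\alpha)^{-1}(O)$ where $\mathcal C=\alpha_X^{-1}(O)$. With the embedding $\mathrm{id}_G\cup\iota^\alpha$ of $|G|_\Omega$, $\alpha G$ is an $\Omega$-compactification of $G$, said to be induced by $\mathscr C^\alpha$. A $\mathscr C$-compactification of $G$ is an $\Omega$-compactification induced by a $\mathscr C$-system of $G$. For $\mathscr C$-systems $\mathscr C^\alpha=\{(\alpha(\mathcal C_X),\alpha_X),\mathfrak a_{X',X}\}$ and $\mathscr C^\delta=\{(\delta(\mathcal C_X),\delta_X),\mathfrak d_{X',X}\}$, $\mathscr C^\alpha\le_{\mathscr C}\mathscr C^\delta$ means that for every $X\in\mathcal X$ there is $f_X\colon(\delta(\mathcal C_X),\delta_X)\ge(\alpha(\mathcal C_X),\alpha_X)$ with $f_X\circ\mathfrak d_{X',X}=\mathfrak a_{X',X}\circ f_{X'}$ for all $X\subseteq X'$.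 $\mathscr C$-equivalent means both $\le_{\mathscr C}$ relations hold. $\mathscr C^\Gamma$: $\Gamma_X=\mathcal C_X\sqcup\mathrm{crit}(X)$ with the topology generated by all subsets of $\mathcal C_X$ and the sets $\mathcal C\sqcup\{Y\}$ for $Y\in\mathrm{crit}(X)$ and $\mathcal C$ a cofinite subset of $\mathcal C_X(Y)$; $\mathfrak f_{X',X}\colon\Gamma_{X'}\to\Gamma_X$ is $\mathfrak c_{X',X}$ on $\mathcal C_{X'}$, the identity on $\mathrm{crit}(X')\cap\mathrm{crit}(X)$, and sends $Y\in\mathrm{crit}(X')\setminus\mathrm{crit}(X)$ to $C_X(Y)$. $\mathscr C^\Gamma=\{\Gamma_X,\mathfrak f_{X',X}\}$ (with inclusions $\mathcal C_X\hookrightarrow\Gamma_X$) is a $\mathscr C$-system, and $|G|_\Gamma$ is the $\mathscr C$-compactification it induces. $\mathscr C^{\mathcal U}$: $\mathcal U_X=\beta(\mathcal C_X)$ is the Stone–Čech compactification (space of ultrafilters) of the discrete space $\mathcal C_X$, and the bonding maps are the unique continuous extensions $\beta(\mathfrak c_{X',X})$. This is a $\mathscr C$-system. Tangles. $\vec S$ is the set of ordered pairs $(A,B)$ with $A\cup B=V$, $A\cap B$ finite and no edge between $A\setminus B$ and $B\setminus A$. $(A,B)\le(C,D)$ means $A\subseteq C$, $B\supseteq D$. A star is a set $\sigma\subseteq\vec S$ such that any two distinct $(A,B),(D,C)\in\sigma$ satisfy $(A,B)\le(C,D)$; its interior is $\bigcap_{(A,B)\in\sigma}B$. An $\aleph_0$-tangle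 of $G$ is a set $\tau\subseteq\vec S$ containing exactly one of $(A,B),(B,A)$ for every finite order separation $\{A,B\}$, that is consistent (no two distinct $(B,A),(C,D)\in\tau$ satisfy $(A,B)<(C,D)$) and has no finite star of finite interior as a subset. $\Theta$ is the set of $\aleph_0$-tangles; ends $\omega$ are identified with $\tau_\omega=\{(A,B)\in\vec S\mid C(A\cap B,\omega)\subseteq G[B\setminus A]\}$. $U(\tau,X)=\{\mathcal C\subseteq\mathcal C_X\mid(V\setminus V[\mathcal C],X\cup V[\mathcal C])\in\tau\}$ is an ultrafilter on $\mathcal C_X$, and $\tau\mapsto(U(\tau,X)\mid X\in\mathcal X)$ is a bijection $\Theta\to\mathcal U=\varprojlim\mathcal U_X$ (known, Diestel), by which $\Theta$ and $\mathcal U$ are identified. $|G|_\Theta=G\sqcup\Theta$ has the topology generated by the open sets of $G$ and all sets $\bigcup\mathcal C\cup\mathring E(X,\bigcup\mathcal C)\cup\{\tau\mid\mathcal C\in U(\tau,X)\}$, $X\in\mathcal X$, $\mathcal C\subseteq\mathcal C_X$; it is the $\mathscr C$-compactification induced by $\mathscr C^{\mathcal U}$. For $\tau\in\Upsilon=\Theta\setminus\Omega$ there is a least $X_\tau\in\mathcal X$ for which $U(\tau,X_\tau)$ is free; $\tau\sim\tau'$ iff $X_\tau=X_{\tau'}$. $|G|_\Theta/{\sim}$ is the quotient space obtained by identifying $\sim$-equivalent points of $\Upsilon$. *)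

(* Defs.v *)
From HB Require Import structures.
From mathcomp Require Import all_boot all_order all_algebra finmap generic_quotient.
From mathcomp Require Import all_classical all_reals topology.

Set Implicit Arguments.
Unset Strict Implicit.
Unset Printing Implicit Defensive.

Import Order.TTheory GRing.Theory Num.Theory.

Local Open Scope fset_scope.
Local Open Scope classical_set_scope.

(* Graphs are simple, as in Diestel's textbook: the edges are 2-element sets of
   vertices. A choice structure on the vertices is no restriction, since every
   type has one classically. *)
Record graph := Graph {
  vertex :> choiceType;
  edges : {pred {fset vertex}};
  edges_card : forall e, e \in edges -> #|` e| = 2
}.
Arguments edges : clear implicits.

Section Components.
Context {G : graph}.
Implicit Types (X Y : {fset G}) (x y z : G).

Definition adj x y : bool := [fset x; y] \in edges G.

Lemma adj_sym x y : adj x y = adj y x.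
Proof. by rewrite /adj fsetUC. Qed.

Definition avoid_adj X : rel G :=
  [rel x y | [&& adj x y, x \notin X & y \notin X]].

(* For x, y outside X: x and y are joined by a walk in G - X. *)
Definition reach X x y := exists2 p, path (avoid_adj X) x p & y = last x p.

Lemma reach_refl X x : reach X x x.
Proof. by exists [::]. Qed.

Lemma reach_trans X y x z : reach X x y -> reach X y z -> reach X x z.
Proof.
move=> [p pp ->] [q qq ->]; exists (p ++ q); last by rewrite last_cat.
by rewrite cat_path pp.
Qed.

Lemma reach_sym X x y : reach X x y -> reach X y x.
Proof.
move=> [p pp ->]; exists (rev (belast x p)); last first.
  by case: p {pp} => //= a p; rewrite rev_cons last_rcons.
rewrite rev_path; apply: sub_path pp => u v /and3P[uv uX vX].
by rewrite /avoid_adj /= adj_sym uv uX vX.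
Qed.

Lemma reach1 X x y : adj x y -> x \notin X -> y \notin X -> reach X x y.
Proof. by move=> xy xX yX; exists [:: y] => //; rewrite /= /avoid_adj /= xy xX yX. Qed.

Lemma reach_ind X (P : G -> Prop) x y : reach X x y -> P x ->
  (forall u v, P u -> adj u v -> u \notin X -> v \notin X -> P v) -> P y.
Proof.
move=> [p pp ->] + PS; elim: p x pp => //= a p IH x /andP[/and3P[xa xX aX] pp] Px.
by apply: IH => //; exact: (PS x).
Qed.

Lemma reach_sub X' X x y : (X `<=` X')%fset -> reach X' x y -> reach X x y.
Proof.
move=> /fsubsetP XX' xy; apply: (reach_ind xy); first exact: reach_refl.
move=> u v xu uv uX vX; apply: reach_trans xu _; apply: reach1 => //.
  by apply: contra uX; exact: XX'.
by apply: contra vX; exact: XX'.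
Qed.

Lemma reach_notin X x y : x \notin X -> reach X x y -> y \notin X.
Proof. by move=> xX xy; apply: (@reach_ind X (fun z => z \notin X) x y). Qed.

(* Components of G - X are induced subgraphs; they are represented by their
   vertex sets. *)
Definition is_component X (C : set G) :=
  exists2 x, x \notin X & C = [set y | reach X x y].

Record component X := Comp {
  vset :> set G;
  compP : is_component X vset
}.

HB.instance Definition _ X := gen_eqMixin (component X).
HB.instance Definition _ X := gen_choiceMixin (component X).
HB.instance Definition _ X := hasNbhs.Build (component X) principal_filter.
HB.instance Definition _ X := Discrete_ofNbhs.Build (component X) erefl.

Lemma comp_inj X (C D : component X) : vset C = vset D -> C = D.
Proof.
by case: C D => [C pC] [D pD] /= E; move: pC; rewrite E => pC;
  rewrite (Prop_irrelevance pC pD).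
Qed.

Lemma comp_notin X (C : component X) x : vset C x -> x \notin X.
Proof. by have [c cX ->] := compP C; exact: reach_notin. Qed.

Lemma comp_nonempty X (C : component X) : exists x, vset C x.
Proof. by have [c cX ->] := compP C; exists c; exact: reach_refl. Qed.

Lemma comp_reach X (C : component X) x : vset C x -> vset C = [set y | reach X x y].
Proof.
have [c cX ->] := compP C; move=> /= cx; apply/seteqP; split => y /=.
  exact: reach_trans (reach_sym cx).
exact: reach_trans.
Qed.

Lemma comp_eq X (C D : component X) x : vset C x -> vset D x -> C = D.
Proof. by move=> Cx Dx; apply: comp_inj; rewrite (comp_reach Cx) (comp_reach Dx). Qed.

Lemma comp_ex X x : x \notin X -> exists C : component X, vset C x.
Proof.
move=> xX; have cC : is_component X [set y | reach X x y] by exists x.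
by exists (Comp cC); exact: reach_refl.
Qed.

Lemma comp_map_subproof X' X (h : (X `<=` X')%fset) (C : component X') :
  exists D : component X, C `<=` D.
Proof.
have [x Cx] := comp_nonempty C.
have [|D Dx] := @comp_ex X x; first by apply: contra (comp_notin Cx); exact/fsubsetP.
exists D => y; rewrite (comp_reach Cx) (comp_reach Dx) /=; exact: reach_sub.
Qed.

Definition comp_map X' X (h : (X `<=` X')%fset) (C : component X') : component X :=
  sval (cid (comp_map_subproof h C)).

Lemma comp_map_sub X' X (h : (X `<=` X')%fset) (C : component X') : C `<=` comp_map h C.
Proof. by rewrite /comp_map; case: cid. Qed.

Lemma comp_map_eq X' X (h : (X `<=` X')%fset) (C : component X') (D : component X) x :
  vset C x -> vset D x -> comp_map h C = D.
Proof. by move=> Cx; apply: comp_eq; exact: comp_map_sub Cx. Qed.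

Definition nbhd (C : set G) : set G :=
  [set v | ~ C v /\ exists2 u, C u & adj v u].

Definition comps_nbhd X Y : set (component X) := [set C | nbhd C = [set` Y]].
Arguments comps_nbhd : clear implicits.

Definition comps_verts X (CC : set (component X)) : set G :=
  \bigcup_(C in CC) vset C.

Definition critical X := infinite_set (comps_nbhd X X).

Lemma crit_comp_subproof X Y : critical Y -> ~~ (Y `<=` X)%fset ->
  exists! C : component X, exists2 y, y \in Y & vset C y.
Proof.
move=> cY nYX.
have [C CY CX] : exists2 C, comps_nbhd Y Y C & forall x, vset C x -> x \notin X.
  apply: contrapT => nC; apply: cY.
  case: (pselect (exists C0 : component Y, True)) => [[C0 _]|nC0]; last first.
    by apply: sub_finite_set (@finite_set0 _) => C _; apply: nC0; exists C.
  apply: (@sub_finite_set _ _ ((fun x => xget C0 [set C : component Y | vset C x]) @` [set` X])).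
    move=> C CC; apply: contrapT => nCX; apply: nC; exists C => // x Cx.
    apply/negP => xX; apply: nCX; exists x => //.
    by apply: (@comp_eq _ _ _ x) => //; case: xgetP => [D _ //|/(_ C)/(_ Cx)].
  by apply: finite_image; exact: finite_fset.
have toC y : y \in Y -> exists2 u, vset C u & adj y u.
  move=> yY; have : nbhd C y by rewrite CY.
  by case=> _ [u Cu yu]; exists u.
have reachX u v : vset C u -> vset C v -> reach X u v.
  move=> Cu; rewrite (comp_reach Cu) => /= uv.
  suff [] : reach X u v /\ vset C v by [].
  apply: (@reach_ind Y (fun z => reach X u z /\ vset C z) u v uv).
    by split => //; exact: reach_refl.
  move=> a b [ua Ca] ab aY bY.
  have Cb : vset C b.
    rewrite (comp_reach Cu) /=; apply: reach_trans (reach1 ab aY bY).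
    by move: Ca; rewrite (comp_reach Cu).
  by split => //; apply: reach_trans ua _; apply: reach1 => //; exact: CX.
have conn y z : y \in Y -> z \in Y -> y \notin X -> z \notin X -> reach X y z.
  move=> /toC[u Cu yu] /toC[v Cv zv] yX zX.
  apply: reach_trans (reach1 yu yX (CX _ Cu)) _.
  apply: reach_trans (reachX _ _ Cu Cv) _.
  by apply: reach_sym; exact: reach1 zv zX (CX _ Cv).
have /fsubsetPn[y yY yX] := nYX.
have [D Dy] := comp_ex yX.
exists D; split; first by exists y.
move=> E [z zY Ez]; apply: (@comp_eq _ _ _ z) => //.
by rewrite (comp_reach Dy) /=; apply: conn => //; exact: comp_notin Ez.
Qed.

Definition crit_comp X Y (cY : critical Y) (nYX : ~~ (Y `<=` X)%fset) : component X :=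
  sval (cid (crit_comp_subproof cY nYX)).

Lemma crit_comp_meets X Y (cY : critical Y) (nYX : ~~ (Y `<=` X)%fset) :
  exists2 y, y \in Y & vset (crit_comp cY nYX) y.
Proof. by rewrite /crit_comp; case: cid => C []. Qed.

Lemma crit_comp_eq X Y (cY : critical Y) (nYX : ~~ (Y `<=` X)%fset) (C : component X) y :
  y \in Y -> vset C y -> crit_comp cY nYX = C.
Proof.
by move=> yY Cy; rewrite /crit_comp; case: cid => D [_ DE] /=; apply: DE; exists y.
Qed.

End Components.
Arguments comps_nbhd {G}.

Section Ends.
Context {G : graph}.
Implicit Types (X : {fset G}) (r : nat -> G).

Definition ray r := injective r /\ forall n, adj (r n) (r n.+1).

Definition tail_in r (A : set G) := exists N, forall n, (N <= n)%N -> A (r n).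

Definition ray_equiv r s :=
  forall X, exists C : component X, tail_in r C /\ tail_in s C.

Record graph_end := End {
  end_rays :> set (nat -> G);
  end_raysP : exists2 r, ray r & end_rays = [set s | ray s /\ ray_equiv r s]
}.

Lemma ray_avoid r (F : set G) : ray r -> finite_set F -> tail_in r (~` F).
Proof.
move=> [rI _] /finite_seqP[s ->]; elim: s => [|x s [N IH]].
  by exists 0 => n _ /=; rewrite in_nil.
have [M hM] : exists M, forall n, (M <= n)%N -> r n <> x.
  case: (pselect (exists m, r m = x)) => [[m rm]|nm]; last first.
    by exists 0 => n _ rn; apply: nm; exists n.
  by exists m.+1 => n mn; rewrite -rm => /rI nm; rewrite nm ltnn in mn.
exists (maxn M N) => n; rewrite geq_max => /andP[Mn Nn] /=.
by rewrite inE => /orP[/eqP|]; [exact: hM|exact: IH].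
Qed.

Lemma ray_tail X r : ray r -> exists C : component X, tail_in r C.
Proof.
move=> rr; have [N hN] := ray_avoid rr (finite_fset X).
have nX n : (N <= n)%N -> r n \notin X by move=> /hN /negP.
have [C CN] := comp_ex (nX N (leqnn N)).
exists C, N => n /subnK <-; elim: (n - N)%N => // k IH.
have := IH; rewrite addSn (comp_reach CN) /= => Nk; apply: reach_trans Nk _.
by apply: reach1; [exact: rr.2|apply: nX; exact: leq_addl|
  apply: nX; rewrite -addSn; exact: leq_addl].
Qed.

Lemma tail_in2 r (A B : set G) :
  tail_in r A -> tail_in r B -> tail_in r (A `&` B).
Proof.
move=> [M hM] [N hN]; exists (maxn M N) => n; rewrite geq_max => /andP[Mn Nn].
by split; [exact: hM|exact: hN].
Qed.

Lemma tail_in_sub r (A B : set G) : A `<=` B -> tail_in r A -> tail_in r B.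
Proof. by move=> AB [N hN]; exists N => n /hN; exact: AB. Qed.

Lemma tail_in_ex r (A : set G) : tail_in r A -> exists n, A (r n).
Proof. by move=> [N hN]; exists N; exact: hN. Qed.

Lemma tail_in_eq X r (C D : component X) : tail_in r C -> tail_in r D -> C = D.
Proof. by move=> rC rD; have [n [Cn Dn]] := tail_in_ex (tail_in2 rC rD); exact: comp_eq Cn Dn. Qed.

Lemma end_ray (w : graph_end) : exists2 r, ray r & end_rays w r.
Proof.
have [r rr ->] := end_raysP w; exists r => //; split => // X.
by have [C rC] := ray_tail X rr; exists C.
Qed.

Lemma end_comp_subproof X (w : graph_end) :
  exists C : component X, forall r, end_rays w r -> tail_in r C.
Proof.
have [r rr wE] := end_raysP w; have [C rC] := ray_tail X rr.
exists C => s; rewrite wE => -[_ /(_ X)[D [rD sD]]].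
by rewrite (tail_in_eq rC rD).
Qed.

Definition end_comp X (w : graph_end) : component X := sval (cid (end_comp_subproof X w)).

Lemma end_comp_tail X (w : graph_end) r : end_rays w r -> tail_in r (end_comp X w).
Proof. by rewrite /end_comp; case: cid => C hC /=; exact: hC. Qed.

Lemma comp_map_end X' X (h : (X `<=` X')%fset) (w : graph_end) :
  comp_map h (end_comp X' w) = end_comp X w.
Proof.
have [r rr wr] := end_ray w.
have [n [Cn Dn]] := tail_in_ex (tail_in2 (end_comp_tail X' wr) (end_comp_tail X wr)).
exact: comp_map_eq Cn Dn.
Qed.

End Ends.
Arguments graph_end : clear implicits.

Section Extensions.

(* A pair (K, h) as in the definition of a compactification, without conditions
   on K and h. *)
Record extension (Y : topologicalType) := Extension {
  ext_space :> topologicalType;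
  ext_map : Y -> ext_space
}.

Definition embedding (Y K : topologicalType) (h : Y -> K) :=
  injective h /\
  forall O : set Y, open O <-> exists2 U : set K, open U & O = h @^-1` U.

Definition is_compactification (Y K : topologicalType) (h : Y -> K) :=
  [/\ compact [set: K], embedding h & dense (range h)].

Definition ext_morphism (Y : topologicalType) (K' K : extension Y) (f : K' -> K) :=
  continuous f /\ forall y, f (ext_map K' y) = ext_map K y.

Definition coarser (Y : topologicalType) (K K' : extension Y) :=
  exists f : K' -> K, ext_morphism f.

Definition homeomorphism (K' K : topologicalType) (f : K' -> K) :=
  continuous f /\ exists g : K -> K', [/\ continuous g, cancel f g & cancel g f].

Definition top_equiv (Y : topologicalType) (K K' : extension Y) :=
  exists f : K' -> K, ext_morphism f /\ homeomorphism f.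

Local Open Scope quotient_scope.

Definition quot_ext (Y : topologicalType) (K : extension Y) (e : equiv_rel K) :
    extension Y :=
  @Extension Y (quotient_topology {eq_quot e})
    (fun y => \pi_({eq_quot e}) (ext_map K y)).

Section Fibres.
Context (T U : topologicalType) (f : T -> U).
Definition same_fibre : rel T := fun x y => f x == f y.
Lemma same_fibre_refl : reflexive same_fibre. Proof. by move=> x; exact: eqxx. Qed.
Lemma same_fibre_sym : symmetric same_fibre.
Proof. by move=> x y; exact: eq_sym. Qed.
Lemma same_fibre_trans : transitive same_fibre.
Proof. by move=> y x z /eqP xy /eqP yz; apply/eqP; rewrite xy. Qed.
Canonical fibre_equiv :=
  EquivRel same_fibre same_fibre_refl same_fibre_sym same_fibre_trans.
End Fibres.

Definition is_quotient (Y : topologicalType) (K K' : extension Y) :=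
  exists f : K' -> K, ext_morphism f /\ top_equiv K (quot_ext (fibre_equiv f)).

End Extensions.

Section Spaces.
Context (R : realType) (G : graph).
Local Open Scope ring_scope.

Definition edge := {e : {fset G} | e \in edges G}.

Definition unit_itv := {t : R | 0 < t < 1}.

Lemma edge_tail_subproof (e : edge) : exists v, v \in val e.
Proof.
have := edges_card (valP e); case: (fset_0Vmem (val e)) => [->|[v ve] _].
  by rewrite cardfs0.
by exists v.
Qed.

(* The end of the edge e at the parameter 0, in an arbitrarily chosen
   identification of e with [0, 1]. *)
Definition edge_tail (e : edge) : G := sval (cid (edge_tail_subproof e)).

Variant gpoint :=
  | Vertex of G
  | Inner of edge & unit_itv.

HB.instance Definition _ := gen_eqMixin gpoint.
HB.instance Definition _ := gen_choiceMixin gpoint.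

(* The union of the half-open intervals [v, i e) over the edges e at v. *)
Definition open_star (v : G) (i : edge -> unit_itv) : set gpoint :=
  [set p | match p with
   | Vertex u => u = v
   | Inner e t => v \in val e /\
       if v == edge_tail e then val t < val (i e) else val (i e) < val t
   end].

Definition open_segment (e : edge) (U : set R) : set gpoint :=
  [set p | if p is Inner e' t then e' = e /\ U (val t) else False].

Definition gpoint_basic : set (set gpoint) :=
  [set O | (exists v i, O = open_star v i) \/
           (exists e, exists2 U : set R^o, open U & O = open_segment e U)].

HB.instance Definition _ :=
  @isSubBaseTopological.Build gpoint (set gpoint) gpoint_basic id.

(* The points of G in the union of the graphs in CC or on an open edge between
   X and this union. *)
Definition region X (CC : set (component X)) : set gpoint :=
  [set p | match p with
   | Vertex v => comps_verts CC v
   | Inner e _ =>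
       (exists2 C, CC C & [set` val e] `<=` C) \/
       (exists x y, [/\ x \in X, comps_verts CC y & val e = [fset x; y]])
   end].

(* For a set L of limit points, [B X CC S] says that S is to be the set of
   limit points in a basic open set with trace [region CC] on G. *)
Definition limit_basis (L : Type) :=
  forall X : {fset G}, set (component X) -> set L -> Prop.

Variant add_limits (L : Type) (B : limit_basis L) :=
  | Pt of gpoint
  | Lim of L.
Arguments add_limits {L} B.
Arguments Pt {L B}.
Arguments Lim {L B}.

Section AddLimits.
Context (L : Type) (B : limit_basis L).

HB.instance Definition _ := gen_eqMixin (add_limits B).
HB.instance Definition _ := gen_choiceMixin (add_limits B).

Definition add_limits_basic : set (set (add_limits B)) :=
  [set O | (exists2 U : set gpoint, open U & O = Pt @` U) \/
           (exists X (CC : set (component X)), exists2 S, B CC S &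
              O = Pt @` region CC `|` Lim @` S)].

HB.instance Definition _ :=
  @isSubBaseTopological.Build (add_limits B) (set (add_limits B)) add_limits_basic id.

Definition inner_edges : set (add_limits B) :=
  [set x | exists e t, x = Pt (Inner e t)].

End AddLimits.

Definition add_limits_map (L L' : Type) (B : limit_basis L) (B' : limit_basis L')
    (f : L -> L') (x : add_limits B) : add_limits B' :=
  match x with Pt p => Pt p | Lim l => Lim (f l) end.

Definition end_basis : limit_basis (graph_end G) :=
  fun X CC S => S = [set w | CC (end_comp X w)].

Definition ends_space : topologicalType := add_limits end_basis.

End Spaces.
Arguments Vertex {R G}.
Arguments Inner {R G}.
Arguments Pt {R G L B}.
Arguments Lim {R G L B}.

Record comp_system (G : graph) := CompSystem {
  sys_ext :> forall X : {fset G}, extension (component X);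
  bond : forall X' X, (X `<=` X')%fset -> sys_ext X' -> sys_ext X;
  bond_id : forall X (h : (X `<=` X)%fset) x, bond h x = x;
  bond_comp : forall X'' X' X (h' : (X' `<=` X'')%fset) (h : (X `<=` X')%fset)
    (k : (X `<=` X'')%fset) x, bond h (bond h' x) = bond k x;
  bond_map : forall X' X (h : (X `<=` X')%fset) C,
    bond h (ext_map (sys_ext X') C) = ext_map (sys_ext X) (comp_map h C)
}.

Section Systems.
Context {G : graph}.
Implicit Types a d : comp_system G.

Definition is_Csystem a :=
  (forall X, hausdorff_space (a X) /\ is_compactification (ext_map (a X))) /\
  (forall X' X (h : (X `<=` X')%fset), continuous (@bond G a X' X h)).

Definition Cle a d := exists f : forall X, d X -> a X,
  (forall X, ext_morphism (f X)) /\
  (forall X' X (h : (X `<=` X')%fset) x, f X (bond h x) = bond h (f X' x)).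

Record invlim a := InvLim {
  lim_coord :> forall X, a X;
  lim_coordP : forall X' X (h : (X `<=` X')%fset), bond h (lim_coord X') = lim_coord X
}.

Lemma end_lim_subproof a (w : graph_end G) X' X (h : (X `<=` X')%fset) :
  bond h (ext_map (a X') (end_comp X' w)) = ext_map (a X) (end_comp X w).
Proof. by rewrite bond_map comp_map_end. Qed.

Definition end_lim a (w : graph_end G) : invlim a := InvLim (@end_lim_subproof a w).

Definition sys_basis a : limit_basis G (invlim a) :=
  fun X CC S => exists2 O : set (a X), open O &
    CC = ext_map (a X) @^-1` O /\ S = [set x : invlim a | O (x X)].

Context (R : realType).

Definition induced a : extension (ends_space R G) :=
  @Extension (ends_space R G) (add_limits R (sys_basis (a := a)))
    (add_limits_map _ (end_lim a)).

(* K without the (images of the) inner edge points is a Hausdorff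
   compactification of the space of vertices and ends, by the restriction h
   of the embedding. *)
Definition is_Omega_compactification (K : extension (ends_space R G)) :=
  is_compactification (ext_map K) /\
  let E := @inner_edges R G _ (@end_basis G) in
  exists h : (~` E)%classic -> (~` (ext_map K @` E))%classic,
    [/\ forall x, val (h x) = ext_map K (val x),
        hausdorff_space (~` (ext_map K @` E))%classic &
        is_compactification h].

(* As usual, compactifications are considered up to topological equivalence. *)
Definition is_Ccompactification (K : extension (ends_space R G)) :=
  is_Omega_compactification K /\
  exists2 a, is_Csystem a & top_equiv K (induced a).

End Systems.

Section Gamma.
Context {G : graph}.
Implicit Types X Y : {fset G}.

Record crit_in X := CritIn {
  crit_set :> {fset G};
  crit_sub : (crit_set `<=` X)%fset;
  crit_crit : critical crit_set
}.

Arguments crit_crit {X} _.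

Lemma crit_inj X (Y Z : crit_in X) : crit_set Y = crit_set Z -> Y = Z.
Proof.
case: Y Z => [Y p q] [Z p' q'] /= E; move: p q; rewrite E => p q.
by rewrite (Prop_irrelevance p p') (Prop_irrelevance q q').
Qed.

Variant gamma X :=
  | GComp of component X
  | GCrit of crit_in X.

HB.instance Definition _ X := gen_eqMixin (gamma X).
HB.instance Definition _ X := gen_choiceMixin (gamma X).

Definition gamma_basic X : set (set (gamma X)) :=
  [set O | (exists CC : set (component X), O = @GComp X @` CC) \/
           (exists Y : crit_in X, exists2 CC : set (component X),
              CC `<=` comps_nbhd X Y /\ finite_set (comps_nbhd X Y `\` CC)%classic &
              O = @GComp X @` CC `|` [set GCrit Y])].

HB.instance Definition _ X :=
  @isSubBaseTopological.Build (gamma X) (set (gamma X)) (@gamma_basic X) id.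

Definition gamma_bond X' X (h : (X `<=` X')%fset) (x : gamma X') : gamma X :=
  match x with
  | GComp C => GComp (comp_map h C)
  | GCrit Y =>
      match boolP (crit_set Y `<=` X)%fset with
      | AltTrue YX => GCrit (CritIn YX (crit_crit Y))
      | AltFalse nYX => GComp (crit_comp (crit_crit Y) nYX)
      end
  end.

Lemma gamma_bond_id X (h : (X `<=` X)%fset) x : gamma_bond h x = x.
Proof.
case: x => [C|Y] /=.
  by congr GComp; have [c Cc] := comp_nonempty C; exact: (comp_map_eq _ Cc Cc).
destruct (boolP (crit_set Y `<=` X)%fset) as [YX|nYX]; first by congr GCrit; exact: crit_inj.
by have := crit_sub Y; rewrite (negPf nYX).
Qed.

Lemma gamma_bond_comp X'' X' X (h' : (X' `<=` X'')%fset) (h : (X `<=` X')%fset)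
  (k : (X `<=` X'')%fset) x : gamma_bond h (gamma_bond h' x) = gamma_bond k x.
Proof.
case: x => [C|Y] /=.
  congr GComp; have [c Cc] := comp_nonempty C.
  apply: (@comp_map_eq _ _ _ _ _ _ c); first exact: comp_map_sub.
  exact: comp_map_sub.
destruct (boolP (crit_set Y `<=` X')%fset) as [YX'|nYX']; simpl.
  destruct (boolP (crit_set Y `<=` X)%fset) as [YX|nYX].
    by congr GCrit; exact: crit_inj.
  by [].
have [y yY Cy] := crit_comp_meets (crit_crit Y) nYX'.
destruct (boolP (crit_set Y `<=` X)%fset) as [YX|nYX].
  by have := fsubset_trans YX h; rewrite (negPf nYX').
congr GComp; apply/esym; apply: (crit_comp_eq _ _ yY); exact: comp_map_sub.
Qed.

Definition gamma_ext X : extension (component X) := @Extension (component X) (gamma X) (@GComp X).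

Definition gamma_system : comp_system G :=
  @CompSystem G gamma_ext gamma_bond gamma_bond_id gamma_bond_comp (fun _ _ _ _ => erefl).

End Gamma.

Definition gamma_space (R : realType) (G : graph) : extension (ends_space R G) :=
  induced R (@gamma_system G).

Section Ultra.

Record ultra (T : Type) := Ultra {
  ultra_filter :> set_system T;
  ultraP : UltraFilter ultra_filter
}.

Lemma ultra_inj T (U W : ultra T) : ultra_filter U = ultra_filter W -> U = W.
Proof.
case: U W => [U p] [W q] /= E; move: p; rewrite E => p.
by rewrite (Prop_irrelevance p q).
Qed.

HB.instance Definition _ T := gen_eqMixin (ultra T).
HB.instance Definition _ T := gen_choiceMixin (ultra T).

Definition ultra_basic T : set (set (ultra T)) :=
  [set O | exists A : set T, O = [set U : ultra T | ultra_filter U A]].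

HB.instance Definition _ T :=
  @isSubBaseTopological.Build (ultra T) (set (ultra T)) (@ultra_basic T) id.

Lemma ultra_map_subproof T T' (f : T -> T') (U : ultra T) :
  UltraFilter (f x @[x --> ultra_filter U]).
Proof.
have UU := ultraP U; split; first exact: fmap_proper_filter.
move=> F FF UF; apply/seteqP; split => //.
move=> A FA; have [//|UnA] := in_ultra_setVsetC (f @^-1` A) UU.
have : F (A `&` ~` A) by apply: filterI => //; exact: UF.
by rewrite setICr => /filter_not_empty.
Qed.

Definition ultra_map T T' (f : T -> T') (U : ultra T) : ultra T' :=
  Ultra (ultra_map_subproof f U).

Definition ultra_principal T (x : T) : ultra T := Ultra (principal_filter_ultra x).

Context {G : graph}.
Implicit Types X : {fset G}.

Definition ultra_ext X : extension (component X) :=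
  @Extension (component X) (ultra (component X)) (@ultra_principal (component X)).

(* The continuous extension of comp_map maps an ultrafilter to its image. *)
Definition ultra_bond X' X (h : (X `<=` X')%fset) : ultra_ext X' -> ultra_ext X :=
  ultra_map (comp_map h).

Lemma ultra_bond_id X (h : (X `<=` X)%fset) x : ultra_bond h x = x.
Proof.
apply: ultra_inj; apply/funext => A /=; rewrite /fmap /=; congr (ultra_filter x _).
apply/funext => C /=; congr (A _).
by have [c Cc] := comp_nonempty C; exact: (comp_map_eq _ Cc Cc).
Qed.

Lemma ultra_bond_comp X'' X' X (h' : (X' `<=` X'')%fset) (h : (X `<=` X')%fset)
  (k : (X `<=` X'')%fset) x : ultra_bond h (ultra_bond h' x) = ultra_bond k x.
Proof.
apply: ultra_inj; apply/funext => A /=; rewrite /fmap /=; congr (ultra_filter x _).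
apply/funext => C /=; congr (A _); have [c Cc] := comp_nonempty C.
by apply: (@comp_map_eq _ _ _ _ _ _ c); exact: comp_map_sub.
Qed.

Lemma ultra_bond_map X' X (h : (X `<=` X')%fset) C :
  ultra_bond h (ext_map (ultra_ext X') C) = ext_map (ultra_ext X) (comp_map h C).
Proof.
apply: ultra_inj; apply/funext => A; apply/propext.
by split => /= /principal_filterP AC; apply/principal_filterP.
Qed.

Definition ultra_system : comp_system G :=
  CompSystem ultra_bond_id ultra_bond_comp ultra_bond_map.

End Ultra.

Section Tangles.
Context (R : realType) {G : graph}.
Implicit Types (A B C D : set G) (s : set (set G * set G)).
Local Open Scope classical_set_scope.

Definition finite_sep : set (set G * set G) :=
  [set S | [/\ S.1 `|` S.2 = setT, finite_set (S.1 `&` S.2) &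
    forall u v, (S.1 `\` S.2) u -> (S.2 `\` S.1) v -> ~~ adj u v]].

Definition sep_le (S T : set G * set G) := S.1 `<=` T.1 /\ T.2 `<=` S.2.

Definition star s := s `<=` finite_sep /\
  forall A B C D, s (A, B) -> s (D, C) -> (A, B) <> (D, C) ->
    sep_le (A, B) (C, D).

Definition star_interior s : set G := \bigcap_(S in s) S.2.

Definition is_tangle s := [/\
  s `<=` finite_sep,
  forall A B, finite_sep (A, B) ->
    (s (A, B) \/ s (B, A)) /\ ~ (s (A, B) /\ s (B, A)),
  forall A B C D, s (B, A) -> s (C, D) -> (B, A) <> (C, D) ->
    ~ (sep_le (A, B) (C, D) /\ (A, B) <> (C, D)) &
  forall sg, sg `<=` s -> star sg -> finite_set sg ->
    ~ finite_set (star_interior sg)].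

Record tangle := Tangle {
  tangle_set :> set (set G * set G);
  tangleP : is_tangle tangle_set
}.

Lemma finite_sepC A B : finite_sep (A, B) -> finite_sep (B, A).
Proof.
by move=> [/= U I N]; split => /=; rewrite 1?setUC 1?setIC // => u v Bu Av; rewrite adj_sym; exact: N.
Qed.

Definition end_tangle_set (w : graph_end G) : set (set G * set G) :=
  [set S | finite_sep S /\ end_comp (fset_set (S.1 `&` S.2)) w `<=` S.2 `\` S.1].

Lemma finite_sep_reach A B u v : finite_sep (A, B) ->
  reach (fset_set (A `&` B)) u v -> (B `\` A) u -> (B `\` A) v.
Proof.
move=> [/= U I N] uv Bu.
apply: (@reach_ind _ _ (B `\` A) u v uv) => // a b Ba ab _.
rewrite in_fset_set // => /negP nb.
have nAB : ~ (A `&` B) b by move=> bAB; apply: nb; rewrite inE.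
have : (A `|` B) b by rewrite U.
case=> [Ab|Bb]; last by split => // Ab; apply: nAB.
have : ~~ adj b a by apply: N => //; split => // Bb; apply: nAB.
by rewrite adj_sym ab.
Qed.

Lemma end_tangle_tail w S r : end_tangle_set w S -> end_rays w r -> tail_in r (S.2 `\` S.1).
Proof. by move=> [_ /tail_in_sub wS] wr; apply: wS; exact: end_comp_tail. Qed.

Lemma end_tangle_subproof w : is_tangle (end_tangle_set w).
Proof.
have [r rr wr] := end_ray w; split.
- by move=> S [].
- move=> A B sAB; split; last first.
    move=> [/end_tangle_tail/(_ wr) + /end_tangle_tail/(_ wr)] => rB rA.
    by have [n [[/= Bn nAn] [/= An _]]] := tail_in_ex (tail_in2 rB rA).
  have [U I _] := sAB.
  have [x Cx] := comp_nonempty (end_comp (fset_set (A `&` B)) w).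
  have : ~ (A `&` B) x.
    by move=> xAB; have := comp_notin Cx; rewrite in_fset_set // => /negP; apply; rewrite inE.
  have sBA := finite_sepC sAB.
  have : (A `|` B) x by have -> : A `|` B = setT by [].
  case=> [Ax|Bx] nAB; [right|left]; split => // y /=;
    rewrite ?[B `&` A]setIC (comp_reach Cx) /= => xy.
    by apply: (finite_sep_reach sBA _ _) => /=; rewrite ?[B `&` A]setIC; [exact: xy|split => // Bx; apply: nAB].
  by apply: (finite_sep_reach sAB xy); split => // Ax; apply: nAB.
- move=> A B C D /end_tangle_tail/(_ wr) rA /end_tangle_tail/(_ wr) rD _ [[/= AC _] _].
  have [n [[/= An _] [/= _ nCn]]] := tail_in_ex (tail_in2 rA rD).
  by apply: nCn; exact: AC.
- move=> sg sgw _ /finite_seqP[q sgE] fI.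
  have : tail_in r (star_interior sg).
    have : forall S, S \in q -> tail_in r S.2.
      move=> S Sq; apply: (@tail_in_sub _ _ (S.2 `\` S.1)); first by move=> x [].
      by apply: end_tangle_tail wr; apply: sgw; rewrite sgE.
    rewrite /star_interior sgE; elim: q {sgE} => [|S q IH] hq.
      by exists 0%N => n _ S.
    have /IH : forall T, T \in q -> tail_in r T.2.
      by move=> T Tq; apply: hq; rewrite inE Tq orbT.
    have := hq S (mem_head _ _) => h1 h2; have := tail_in2 h1 h2.
    apply: tail_in_sub => x [Sx qx] T /=; rewrite inE => /orP[/eqP -> //|].
    exact: qx.
  move=> h1; have := ray_avoid rr fI => h2.
  by have [n []] := tail_in_ex (tail_in2 h1 h2).
Qed.

Definition end_tangle (w : graph_end G) : tangle := Tangle (end_tangle_subproof w).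

Definition tangle_ultra (t : tangle) (X : {fset G}) : set (set (component X)) :=
  [set CC | tangle_set t (~` comps_verts CC, [set` X] `|` comps_verts CC)].

Definition tangle_basis : limit_basis G tangle :=
  fun X CC S => S = [set t | tangle_ultra t CC].

Definition not_end (t : tangle) := forall w, t <> end_tangle w.

Definition free_at (t : tangle) (X : {fset G}) :=
  \bigcap_(CC in @tangle_ultra t X) CC = set0.

(* The least X at which t is free; set0 if there is none. *)
Definition least_free (t : tangle) : {fset G} :=
  xget fset0 [set X | free_at t X /\ forall Y, free_at t Y -> (X `<=` Y)%fset].

Definition tangle_twin (t t' : tangle) :=
  [/\ not_end t, not_end t' & least_free t = least_free t'].

Definition tangle_space : extension (ends_space R G) :=
  @Extension (ends_space R G) (add_limits R tangle_basis)
    (add_limits_map _ end_tangle).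

Definition twin : rel tangle_space := fun x y => `[<
  x = y \/ exists t t', [/\ x = Lim t, y = Lim t' & tangle_twin t t'] >].

Lemma twin_refl : reflexive twin.
Proof. by move=> x; apply/asboolP; left. Qed.

Lemma twin_sym : symmetric twin.
Proof.
suff H x y : twin x y -> twin y x by move=> x y; apply/idP/idP; exact: H.
move=> /asboolP[->|[t [t' [-> -> [nt nt' E]]]]]; apply/asboolP; first by left.
by right; exists t', t.
Qed.

Lemma twin_trans : transitive twin.
Proof.
move=> y x z /asboolP[->//|[t [t' [-> -> [nt nt' E]]]]] /asboolP[<-|].
  by apply/asboolP; right; exists t, t'.
move=> [u [u' [[<-] -> [nu nu' E']]]]; apply/asboolP; right; exists t, u'.
by split => //; split => //; rewrite E.
Qed.

Canonical twin_equiv := EquivRel twin twin_refl twin_sym twin_trans.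

End Tangles.
Arguments tangle : clear implicits.
Arguments tangle_space R G : clear implicits.
Arguments twin_equiv R G : clear implicits.

(* Main.v *)
(* Extending [component X -> a X] along ultrafilters makes the Stone-Cech system
   the greatest one. In a compactification [a X] of the discrete space of
   components, a point outside the image lies in the closure of the components
   with neighbourhood [Y] for exactly one [Y]: two such sets [Y] are told apart by
   the bonding map to a smaller vertex set, which sends the components of one kind
   to a single isolated point. Sending each such point to its [Y] makes the system
   of critical sets the least one.

   Maps between systems induce maps between the compactifications. The edges
   meeting a set of components of [G - X] are exactly those of its region, so a
   basic neighbourhood of a limit point is the preimage of an open subset of [a X]
   under a partial map, and compactness can be tested on ultrafilters. Away from
   the inner points of edges the spaces are compact Hausdorff; this makes the
   induced maps quotient maps, although the whole spaces need not be
   Hausdorff.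

   Tangles correspond to the points of the inverse limit of ultrafilters, and ends
   to those whose ultrafilters are all principal. The map to the system of critical
   sets remembers of a tangle that is not an end only its critical set, which is
   the least set at which the tangle is free. *)

Require Import Defs.
From mathcomp Require Import all_boot all_order all_algebra finmap generic_quotient.
From mathcomp Require Import all_classical all_reals topology num_normedtype normed_module.

Set Implicit Arguments.
Unset Strict Implicit.
Unset Printing Implicit Defensive.

Import Order.TTheory GRing.Theory Num.Theory numFieldNormedType.Exports.

Local Open Scope fset_scope.
Local Open Scope classical_set_scope.

(** * Subbases and ultrafilters *)

(** A vertex that has a neighbour in every neighbourhood of a limit point cannot be separated from
    that limit point, because basic neighbourhoods of limit points contain whole open edges. Hence
    closedness of a continuous surjection is available only on vertices and limit points. Separation
    is therefore stated for open sets that may meet in inner points of edges, and an edge that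
    leaves a given set is represented by its end vertices. That every compatible family of
    components comes from an end is proved by constructing a ray. This is what gives a tangle that
    is not an end a nonprincipal ultrafilter over some finite set. The construction depends on
    whether infinitely many vertices dominate the family. *)

Section Subbase.
Variables (T : topologicalType) (D : set (set T)).

(** This is the family of open sets that [isSubBaseTopological] builds, so for the four spaces
    defined by a subbase it holds by conversion. *)
Definition is_subbase := @open T = [set \bigcup_(A in F) A | F in subset^~ (finI_from D id)].
Hypothesis TD : is_subbase.

Lemma subbase_open A : D A -> open A.
Proof.
move=> DA; rewrite TD; exists [set A]; last by rewrite bigcup_set1.
by move=> _ ->; exact: finI_from1.
Qed.

Lemma subbase_ind (P : set T -> Prop) :
  P setT -> (forall A B, P A -> P B -> P (A `&` B)) ->
  (forall F : set (set T), F `<=` P -> P (\bigcup_(A in F) A)) ->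
  D `<=` P -> forall O, open O -> P O.
Proof.
move=> PT PI PU DP O; rewrite TD => -[F FD <-]; apply: PU => _ /FD[E ED <-].
have : {in E, forall i, P i} by move=> i /ED; rewrite inE => /DP.
rewrite bigcap_fset => {ED}.
elim/finSet_rect: E => E IH PE.
have [->|[i iE]] := fset_0Vmem E; first by rewrite big_seq_fset0.
rewrite (big_fsetD1 i) //=; apply: PI; first exact: PE.
apply: IH; first by rewrite fproperD1.
by move=> j /fsetD1P[_]; exact: PE.
Qed.

Lemma subbase_cvg (F : set_system T) (x : T) : Filter F ->
  (forall A, D A -> A x -> F A) -> F --> x.
Proof.
move=> FF DF A; rewrite nbhsE => -[O [oO Ox] OA]; apply: filterS OA _.
move: x DF Ox; pattern O; apply: (subbase_ind _ _ _ _ oO).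
- by move=> *; exact: filterT.
- by move=> B C FB FC x DF [Bx Cx]; apply: filterI; [exact: FB DF Bx|exact: FC DF Cx].
- move=> G GF x DF [B GB Bx]; apply: filterS (GF _ GB _ DF Bx).
  exact: bigcup_sup.
- by move=> B DB x; apply.
Qed.

Lemma subbase_continuous (S : topologicalType) (f : S -> T) :
  (forall A, D A -> open (f @^-1` A)) -> continuous f.
Proof.
move=> Df x; apply: subbase_cvg => A DA Ax.
by apply: open_nbhs_nbhs; split => //; exact: Df.
Qed.

End Subbase.

Lemma add_limits_subbase (R : realType) (G : graph) L (B : limit_basis G L) :
  is_subbase (@add_limits_basic R G L B).
Proof. by []. Qed.

Lemma gpoint_subbase (R : realType) (G : graph) : is_subbase (@gpoint_basic R G).
Proof. by []. Qed.

Lemma gamma_subbase (G : graph) X : is_subbase (@gamma_basic G X).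
Proof. by []. Qed.

Lemma ultra_subbase T : is_subbase (@ultra_basic T).
Proof. by []. Qed.

Lemma open_component (G : graph) (X : {fset G}) (A : set (component X)) : open A.
Proof. exact: discrete_open. Qed.

Lemma ultra_dichotomy T (F : set_system T) : Filter F -> ~ F set0 ->
  (forall A, F A \/ F (~` A)) -> UltraFilter F.
Proof.
move=> FF F0 FU; split; first by split.
move=> H HH FH; apply/seteqP; split=> // A HA.
have [//|FnA] := FU A; suff : H (A `&` ~` A) by rewrite setICr => /filter_not_empty.
by apply: filterI => //; exact: FH.
Qed.

Lemma ultra_finite_cover T (I : choiceType) (D : {fset I}) (B : I -> set T)
    (F : set_system T) :
  UltraFilter F -> F (\bigcup_(i in [set` D]) B i) -> exists2 i, i \in D & F (B i).
Proof.
move=> FF FB; apply: contrapT => nF.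
have FN : F (\bigcap_(i in [set` D]) ~` B i).
  apply: filter_bigI => i iD; have [FBi|//] := in_ultra_setVsetC (B i) FF.
  by case: nF; exists i.
by have [x [[i iD Bx] /(_ i iD)]] := filter_ex (filterI FB FN).
Qed.

(** * Separation, density and compactness *)

Section Topology.
Implicit Types T K : topologicalType.

Lemma hausdorffP T : (forall p q : T, p <> q ->
  exists U V, [/\ open U, open V, U p, V q & U `&` V = set0]) -> hausdorff_space T.
Proof.
move=> sep p q pq; apply: contrapT => /sep[U [V [oU oV Up Vq UV]]].
have [x] := pq U V (open_nbhs_nbhs (conj oU Up)) (open_nbhs_nbhs (conj oV Vq)).
by rewrite UV.
Qed.

Lemma hausdorff_sep T (p q : T) : hausdorff_space T -> p <> q ->
  exists U V, [/\ open U, open V, U p, V q & U `&` V = set0].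
Proof.
move=> + /eqP pq; rewrite open_hausdorff => /(_ p q pq)[[U V] /= [Up Vq]].
by case=> oU oV /eqP UV; exists U, V; split => //; exact: set_mem.
Qed.

Lemma dense_continuous_eq T K (f g : T -> K) (A : set T) :
  hausdorff_space K -> continuous f -> continuous g -> dense A ->
  (forall x, A x -> f x = g x) -> f =1 g.
Proof.
move=> HK cf cg dA fg x; apply: contrapT => /(hausdorff_sep HK)[U [V [oU oV Ux Vx UV]]].
have [||y [[Uy Vy] Ay]] := dA (f @^-1` U `&` g @^-1` V).
- by exists x.
- by apply: openI; [move/continuousP: cf|move/continuousP: cg]; apply.
have : (U `&` V) (f y) by split => //; rewrite fg.
by rewrite UV.
Qed.

Lemma range_comp_dense T K (h : T -> K) : dense (range h) ->
  forall O : set K, open O -> O !=set0 -> exists x, O (h x).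
Proof. by move=> dh O oO O0; have [y [Oy [x _ xy]]] := dh _ O0 oO; exists x; rewrite xy. Qed.

Lemma closure_finite_cover T (I : choiceType) (D : {fset I})
    (B : I -> set T) x :
  closure (\bigcup_(i in [set` D]) B i) x -> exists2 i, i \in D & closure (B i) x.
Proof.
move=> Bx; apply: contrapT => nB.
suff /Bx[y [[i iD By] /(_ i iD)]] : nbhs x (\bigcap_(i in [set` D]) ~` B i) by [].
apply: filter_bigI => i iD.
have : ~ closure (B i) x by move=> Bix; apply: nB; exists i.
rewrite /closure /= -existsNE => -[A /not_implyP[Ax nBA]].
by apply: filterS Ax => y Ay By; apply: nBA; exists y.
Qed.

Lemma closure_finite_image (T : topologicalType) (S : Type) (f : S -> T) (A : set S) :
  hausdorff_space T -> finite_set A -> closure (f @` A) = f @` A.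
Proof.
move=> HT fA; apply/esym/closure_id.
have /accessible_finite_set_closed := hausdorff_accessible HT; apply; exact: finite_image.
Qed.

Lemma set_type_compact (T : topologicalType) (A : set T) :
  compact A -> compact [set: set_type A].
Proof.
rewrite compact_ultra => cA; rewrite compact_ultra => F FF _ /=.
have UU := ultraP (ultra_map (val : A -> T) (Ultra FF)).
have [|p [Ap Fp]] := cA _ UU.
  by apply: (@filterS _ F _ _ _ _ filterT) => x _ /=; exact: set_valP.
exists (exist _ p (mem_set Ap)); split => // B.
rewrite nbhsE => -[O [[W oW <-] Op] OB]; apply: filterS OB _.
by apply: Fp; apply: open_nbhs_nbhs.
Qed.

Lemma compact_image (T U : topologicalType) (f : T -> U) (A : set T) :
  continuous f -> compact A -> compact (f @` A).
Proof. by move=> fc cA; apply: continuous_compact cA; exact: continuous_subspaceT. Qed.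

(** The classical proof that compact subsets of a Hausdorff space are closed, run inside [H]: the
    separating open sets may meet outside [H]. In the application [H] is the complement of the inner
    points of edges. *)
Lemma compact_closed_in (T : topologicalType) (H A : set T) :
  (forall p q, H p -> H q -> p <> q ->
    exists U V, [/\ open U, open V, U p, V q & U `&` V `<=` ~` H]) ->
  closed H -> A `<=` H -> compact A -> closed A.
Proof.
move=> sepH cH AH cA p cAp.
have Hp : H p by apply: cH; exact: closureS AH _ cAp.
have PF : ProperFilter (within A (nbhs p)).
  by apply: within_nbhs_proper.
have [q [Aq clq]] := cA _ PF (withinT _ _).
have [<- //|pq] := pselect (q = p).
have [U [V [oU oV Uq Vp UV]]] := sepH _ _ (AH _ Aq) Hp pq.
have WV : within A (nbhs p) (V `&` A).
  rewrite /within /=; apply: filterS (open_nbhs_nbhs (conj oV Vp)) => x Vx Ax.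
  by split.
have [x [[Vx Ax] Ux]] := clq _ _ WV (open_nbhs_nbhs (conj oU Uq)).
by case: (UV x) => //; exact: AH.
Qed.

End Topology.

(** * Hausdorff compactifications of discrete spaces *)

Section DiscreteCompactification.
Variables (D K : topologicalType) (h : D -> K).
Hypotheses (oD : forall A : set D, open A) (HK : hausdorff_space K)
  (hK : is_compactification h).

Lemma embed_inj : injective h. Proof. by case: hK => _ []. Qed.

(** An open set [U] that traces only [d] on [D] is already this singleton: [U] without the closed
    point [h d] is open, and if nonempty it would meet the dense range of [h]. *)
Lemma embed_isolated d : open [set h d].
Proof.
have [_ [hI hO] hd] := hK.
have [U oU dU] := (hO [set d]).1 (oD _).
have c1 : closed [set h d].
  by apply: accessible_closed_set1; exact: hausdorff_accessible.
suff -> : [set h d] = U by [].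
apply/seteqP; split=> [_ ->|x Ux].
  by have : [set d] d by []; rewrite dU.
apply: contrapT => xd.
have [||e [Ue ed]] := @range_comp_dense _ _ _ hd (U `&` ~` [set h d]).
- by apply: openI => //; rewrite openC.
- by exists x.
have ede : [set d] e by rewrite dU.
by apply: ed; rewrite ede.
Qed.

Lemma embed_image_open (A : set D) : open (h @` A).
Proof.
have -> : h @` A = \bigcup_(d in A) [set h d].
  apply/seteqP; split=> [_ [d Ad <-]|_ [d Ad ->]]; by exists d.
by apply: bigcup_open => d _; exact: embed_isolated.
Qed.

End DiscreteCompactification.

(** * The space of ultrafilters *)

Section UltraSpace.
Variable T : Type.
Implicit Types (U W : ultra T) (A : set T).

Lemma ultra_basic_open A : open [set U : ultra T | ultra_filter U A].
Proof. by apply: (subbase_open (ultra_subbase T)); exists A. Qed.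

Lemma ultra_open_basic (O : set (ultra T)) U : open O -> O U ->
  exists2 A, ultra_filter U A & [set W | ultra_filter W A] `<=` O.
Proof.
move=> oO; move: U; pattern O; apply: (subbase_ind (ultra_subbase T) _ _ _ _ oO).
- by move=> U _; exists setT => //; have := ultraP U => ?; exact: filterT.
- move=> A B PA PB U [/PA[C UC CA] /PB[D UD DB]]; have UU := ultraP U.
  exists (C `&` D); first exact: filterI.
  move=> W /= WCD; have WW := ultraP W.
  by split; [apply: CA|apply: DB]; apply: filterS WCD => x [].
- by move=> F FP U [A FA /(FP _ FA)[C UC CA]]; exists C => // W /CA AW; exists A.
- by move=> _ [A ->] U UA; exists A.
Qed.

Lemma ultra_hausdorff : hausdorff_space (ultra T).
Proof.
apply: hausdorffP => U W UW.
have UU := ultraP U; have WW := ultraP W.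
have [A UA nWA] : exists2 A, ultra_filter U A & ~ ultra_filter W A.
  apply: contrapT => nA; apply: UW; apply: ultra_inj; apply/esym.
  by apply: max_filter => A UA; apply: contrapT => WA; apply: nA; exists A.
have [//|WnA] := in_ultra_setVsetC A WW.
exists [set V | ultra_filter V A], [set V | ultra_filter V (~` A)].
split; try exact: ultra_basic_open; rewrite // -subset0 => V [/= VA VnA].
have VV := ultraP V; have : ultra_filter V (A `&` ~` A) by exact: filterI.
by rewrite setICr => /filter_not_empty.
Qed.

Lemma ultra_compact : compact [set: ultra T].
Proof.
rewrite compact_ultra => F FF _ /=.
(* The limit of [F] consists of the sets [A] whose basic open set belongs to [F]. *)
have UW : UltraFilter [set A | F [set U : ultra T | ultra_filter U A]].
  apply: ultra_dichotomy => [||A].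
  - split=> /=.
    + rewrite (_ : [set U | _] = setT); first exact: filterT.
      by apply/seteqP; split=> // U _ /=; have UU := ultraP U; exact: filterT.
    + move=> A B /= FA FB; apply: filterS (filterI FA FB) => U [/= UA UB].
      by have UU := ultraP U; exact: filterI.
    + move=> A B AB /= FA; apply: filterS FA => U /= UA.
      by have UU := ultraP U; exact: filterS UA.
  - rewrite /= (_ : [set U | _] = set0); first exact: filter_not_empty.
    rewrite -subset0 => U /= U0; have UU := ultraP U.
    by move: U0 => /filter_not_empty.
  - have [|FnA] := in_ultra_setVsetC [set U : ultra T | ultra_filter U A] FF; [by left|right].
    apply: filterS FnA => U /= UA.
    by have UU := ultraP U; have [] := in_ultra_setVsetC A UU.
exists (Ultra UW); split => //; apply: (subbase_cvg (ultra_subbase T)).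
by move=> _ [A ->].
Qed.

Lemma ultra_principalE (x : T) A : ultra_filter (ultra_principal x) A <-> A x.
Proof. exact: principal_filterP. Qed.

End UltraSpace.

Lemma ultra_compactification (T : topologicalType) :
  (forall A : set T, open A) -> is_compactification (@ultra_principal T).
Proof.
move=> oT; split; first exact: ultra_compact.
  split=> [x y xy|O].
    have /ultra_principalE : ultra_filter (ultra_principal x) [set y].
      by rewrite xy; exact/ultra_principalE.
    by [].
  split=> [_|_]; last exact: oT.
  exists [set U : ultra T | ultra_filter U O]; first exact: ultra_basic_open.
  by apply/seteqP; split=> x /=; move/(ultra_principalE x O).
move=> O [U OU] oO; have [A UA AO] := ultra_open_basic oO OU.
have UU := ultraP U; have [x Ax] := filter_ex UA.
by exists (ultra_principal x); split; [apply: AO; exact/ultra_principalE|exists x].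
Qed.

Lemma ultra_map_continuous T T' (f : T -> T') : continuous (@ultra_map T T' f).
Proof.
apply: (subbase_continuous (ultra_subbase T')) => _ [A ->].
exact: (@ultra_basic_open _ (f @^-1` A)).
Qed.

Lemma ultra_Csystem (G : graph) : is_Csystem (ultra_system (G := G)).
Proof.
split=> [X|X' X h]; last exact: ultra_map_continuous.
split; first exact: ultra_hausdorff.
by apply: ultra_compactification; exact: open_component.
Qed.

(** * Extending maps along ultrafilters *)

Section UltraExtension.
Variables (T : Type) (K : topologicalType) (h : T -> K).
Hypotheses (HK : hausdorff_space K) (cK : compact [set: K]).

Lemma ultra_lim_subproof (U : ultra T) :
  exists p : K, h x @[x --> ultra_filter U] --> p.
Proof.
have UU := ultraP (ultra_map h U); move: cK; rewrite compact_ultra.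
by move=> /(_ _ UU filterT)[p [_ hp]]; exists p.
Qed.

Definition ultra_lim (U : ultra T) : K := sval (cid (ultra_lim_subproof U)).

Lemma ultra_limP U : h x @[x --> ultra_filter U] --> ultra_lim U.
Proof. by rewrite /ultra_lim; case: cid. Qed.

(** By regularity a neighbourhood of the limit contains the closure of some smaller neighbourhood
    [W], and every ultrafilter containing the preimage of [W] has its limit in that closure. *)
Lemma ultra_lim_continuous : continuous ultra_lim.
Proof.
move=> U V VU.
have [W WU WV] := compact_regular HK cK filterT VU.
have : ultra_filter U (h @^-1` W) by exact: ultra_limP.
move=> UW; apply: filterS (open_nbhs_nbhs (conj (ultra_basic_open _) UW)).
move=> S SW; apply: WV => B /(@ultra_limP S) SB; have SS := ultraP S.
by have [x [Wx Bx]] := filter_ex (filterI SW SB); exists (h x).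
Qed.

Lemma ultra_lim_principal x : ultra_lim (ultra_principal x) = h x.
Proof.
apply: contrapT => /(hausdorff_sep HK)[A [B [oA oB Ax Bx AB]]].
have /ultra_principalE Ahx : ultra_filter (ultra_principal x) (h @^-1` A).
  by apply: (@ultra_limP (ultra_principal x) A); exact: open_nbhs_nbhs.
have : (A `&` B) (h x) by [].
by rewrite AB.
Qed.

End UltraExtension.

(** The two sides of the compatibility equation are continuous into a Hausdorff space and agree on
    the principal ultrafilters, which are dense. *)
Lemma Cle_ultra (G : graph) (a : comp_system G) : is_Csystem a -> Cle a ultra_system.
Proof.
move=> [aK ac].
have cK X : compact [set: a X] by have [_ []] := aK X.
pose f X := ultra_lim (ext_map (a X)) (cK X).
exists f; split=> [X|X' X h].
  have [HX cX] := aK X; split; first by apply: ultra_lim_continuous.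
  by move=> C; exact: ultra_lim_principal.
have [uK uc] := ultra_Csystem G; have [HX [_ _ dX]] := uK X'.
apply: (dense_continuous_eq (aK X).1 _ _ dX) => [x|x|_ [C _ <-]].
- apply: continuous_comp; first exact: uc.
  by apply: ultra_lim_continuous; exact: (aK X).1.
- apply: continuous_comp; last exact: ac.
  by apply: ultra_lim_continuous; exact: (aK X').1.
have := bond_map ultra_system h C; rewrite /= => ->.
by rewrite /f !ultra_lim_principal ?bond_map //; [exact: (aK X').1|exact: (aK X).1].
Qed.

(** * The system of critical sets *)

Section Neighbourhoods.
Context {G : graph}.
Implicit Types X Y : {fset G}.

Lemma nbhd_comp_sub X (C : component X) : nbhd C `<=` [set` X].
Proof.
move=> v [nCv [u Cu vu]]; apply: contrapT => /negP vX; apply: nCv.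
rewrite (comp_reach Cu); apply: reach1 => //; last exact: comp_notin Cu.
by rewrite adj_sym.
Qed.

(** A walk that avoids [X] cannot leave [C]: its first vertex outside [C] would lie in [nbhd C] and
    hence in [X]. *)
Lemma comp_map_vset X' X (h : (X `<=` X')%fset) (C : component X') :
  nbhd C `<=` [set` X] -> comp_map h C = C :> set G.
Proof.
move=> NX; apply/seteqP; split; last exact: comp_map_sub.
have [x Cx] := comp_nonempty C; move=> y.
rewrite (comp_reach (comp_map_sub h Cx)) => /= xy.
apply: (@reach_ind _ _ (vset C) x y xy Cx) => u v Cu uv uX vX; apply: contrapT => nCv.
by move/negP: vX; apply; apply: NX; split => //; exists u => //; rewrite adj_sym.
Qed.

Lemma comps_meet_finite X (F : set G) : finite_set F ->
  finite_set [set C : component X | exists2 x, F x & vset C x].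
Proof.
move=> fF; have [[C0 _]|nC] := pselect (exists C0 : component X, True); last first.
  by apply: sub_finite_set (@finite_set0 _) => C _; apply: nC; exists C.
apply: (@sub_finite_set _ _ ((fun x => xget C0 [set C : component X | vset C x]) @` F)).
  move=> C [x Fx Cx]; exists x => //.
  by apply: (@comp_eq _ _ _ _ x) => //; case: xgetP => [D _ //|/(_ C)/(_ Cx)].
exact: finite_image.
Qed.

(** Walks in [G - X] from a vertex of [D] stay in [D], so they avoid [X'] as well. *)
Lemma avoid_comp X' X (D : component X) : (X `<=` X')%fset ->
  (forall x, vset D x -> x \notin X') -> exists C : component X', vset C = vset D.
Proof.
move=> h DX'; have [x Dx] := comp_nonempty D; have [C Cx] := comp_ex (DX' _ Dx).
exists C; apply/seteqP; split=> y.
  by rewrite (comp_reach Cx) (comp_reach Dx); exact: reach_sub.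
rewrite (comp_reach Dx) => /= xy.
suff [] : vset C y /\ vset D y by [].
apply: (@reach_ind _ _ (fun z => vset C z /\ vset D z) x y xy) => // u v [Cu Du] uv uX vX.
have Dv : vset D v.
  rewrite (comp_reach Du); exact: reach1.
by split=> //; rewrite (comp_reach Cu); apply: reach1 => //; exact: DX'.
Qed.

Lemma comps_nbhd_map X' X Y (h : (X `<=` X')%fset) (C : component X') :
  (Y `<=` X)%fset -> comps_nbhd X' Y C ->
  comps_nbhd X Y (comp_map h C) /\ comp_map h C = C :> set G.
Proof.
move=> /fsubsetP YX NC; suff E : comp_map h C = C :> set G.
  by split => //; rewrite /comps_nbhd /= E.
by apply: comp_map_vset; rewrite NC; exact: YX.
Qed.

(** A component of [G - X] with neighbourhood [Y] is also a component of [G - Y], with the same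
    vertex set, so distinct ones stay distinct. *)
Lemma infinite_critical X Y : (Y `<=` X)%fset ->
  infinite_set (comps_nbhd X Y) -> critical Y.
Proof.
move=> YX; apply: contra_not => fY.
have I : {in comps_nbhd X Y &, injective (comp_map YX)}.
  move=> C D /set_mem YC /set_mem YD E; apply: comp_inj.
  by rewrite -(comps_nbhd_map YX _ YC).2 // -(comps_nbhd_map YX _ YD).2 // E.
rewrite -(eq_finite_set (inj_card_eq I)); apply: sub_finite_set fY.
by move=> _ [C YC <-]; exact: (comps_nbhd_map _ _ YC).1.
Qed.

(** Only finitely many components of [G - Y] meet the finite set [X]; all others survive unchanged
    as components of [G - X]. *)
Lemma critical_infinite X Y : (Y `<=` X)%fset -> critical Y ->
  infinite_set (comps_nbhd X Y).
Proof.
move=> YX cY fX; apply: cY.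
apply: (@sub_finite_set _ _ (comp_map YX @` comps_nbhd X Y `|`
   [set C : component Y | exists2 x, x \in X & vset C x])); last first.
  rewrite finite_setU; split; first exact: finite_image.
  by apply: comps_meet_finite; exact: finite_fset.
move=> D YD; have [?|nX] := pselect (exists2 x, x \in X & vset D x); [by right|left].
have [|C CD] := @avoid_comp X Y D YX.
  by move=> x Dx; apply/negP => xX; apply: nX; exists x.
exists C; first by rewrite /comps_nbhd /= CD.
have [x Cx] := comp_nonempty C; apply: (comp_map_eq _ Cx); by rewrite -CD.
Qed.
Lemma comps_nbhd_inj X Y Z (C : component X) :
  comps_nbhd X Y C -> comps_nbhd X Z C -> Y = Z.
Proof.
rewrite /comps_nbhd /= => -> E; apply/fsetP => y.
by have := congr1 (fun A => A y) E; rewrite /= => /is_true_inj.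
Qed.

End Neighbourhoods.

(** * The spaces of components and critical sets *)

Section Gamma.
Context {G : graph}.
Implicit Types X Y : {fset G}.

Lemma comp_component_nbhd X (C : component X) : exists2 Y,
  (Y `<=` X)%fset & comps_nbhd X Y C.
Proof.
exists (fset_set (nbhd C)); last first.
  rewrite /comps_nbhd /= fset_setK //.
  exact: sub_finite_set (@nbhd_comp_sub _ _ _) (finite_fset X).
apply/fsubsetP => x; rewrite in_fset_set ?inE; first exact: nbhd_comp_sub.
exact: sub_finite_set (@nbhd_comp_sub _ _ _) (finite_fset X).
Qed.

Lemma gamma_comp_open X (CC : set (component X)) : open (@GComp G X @` CC).
Proof. by apply: (subbase_open (@gamma_subbase G X)); left; exists CC. Qed.

Lemma gamma_crit_open X (Y : crit_in X) (CC : set (component X)) :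
  CC `<=` comps_nbhd X Y -> finite_set (comps_nbhd X Y `\` CC) ->
  open (@GComp G X @` CC `|` [set GCrit Y]).
Proof.
by move=> *; apply: (subbase_open (@gamma_subbase G X)); right; exists Y, CC.
Qed.

Lemma gamma_crit_nbhs X (Y : crit_in X) (O : set (gamma X)) : open O -> O (GCrit Y) ->
  exists CC, [/\ CC `<=` comps_nbhd X Y, finite_set (comps_nbhd X Y `\` CC) &
    @GComp G X @` CC `<=` O].
Proof.
move=> oO; move: Y; pattern O; apply: (subbase_ind (@gamma_subbase G X) _ _ _ _ oO).
- by move=> Y _; exists (comps_nbhd X Y); split => //; rewrite setDv; exact: finite_set0.
- move=> A B PA PB Y [/PA[C [CY fC CA]] /PB[D [DY fD DB]]].
  exists (C `&` D); split; first by move=> x [/CY].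
    by rewrite setDIr finite_setU.
  by move=> _ [x [Cx Dx] <-]; split; [apply: CA|apply: DB]; exists x.
- move=> F FP Y [A FA /(FP _ FA)[C [CY fC CA]]]; exists C; split => // x /CA Ax.
  by exists A.
- move=> _ [[CC ->] Y [] //|[Y [CC [CCY fCC] ->]] Z [[] //|[->]]].
  by exists CC; split => // x; left.
Qed.

(** Two critical sets are separated because a component has only one neighbourhood. Components are
    isolated, and deleting one from a cofinite set leaves it cofinite. *)
Lemma gamma_hausdorff X : hausdorff_space (gamma X : topologicalType).
Proof.
have sep1 (C : component X) (q : gamma X) : GComp C <> q ->
    exists U V, [/\ open U, open V, U (GComp C), V q & U `&` V = set0].
  move=> Cq; exists (@GComp G X @` [set C]).
  case: q Cq => [D|Y] Cq.
    exists (@GComp G X @` [set D]); split; try exact: gamma_comp_open.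
    - by exists C.
    - by exists D.
    - by rewrite -subset0 => x [[_ -> <-] [_ -> /esym/Cq]].
  exists (@GComp G X @` (comps_nbhd X Y `\ C) `|` [set GCrit Y]); split.
  - exact: gamma_comp_open.
  - apply: gamma_crit_open; first by move=> x [].
    apply: sub_finite_set (finite_set1 C) => x [Yx nx].
    by apply: contrapT => xC; apply: nx.
  - by exists C.
  - by right.
  - by rewrite -subset0 => x [[_ -> <-] [[D [_ DC] [/DC]]|]].
apply: hausdorffP => -[C q|Y [C|Z]]; first exact: sep1.
  move=> /nesym/sep1[U [V [oU oV UC VY UV]]].
  by exists V, U; split => //; rewrite setIC.
move=> YZ; exists (@GComp G X @` comps_nbhd X Y `|` [set GCrit Y]).
exists (@GComp G X @` comps_nbhd X Z `|` [set GCrit Z]); split.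
- by apply: gamma_crit_open => //; rewrite setDv; exact: finite_set0.
- by apply: gamma_crit_open => //; rewrite setDv; exact: finite_set0.
- by right.
- by right.
rewrite -subset0 => x [[[C YC <-]|->] [[D ZD E]|E]] //; case: E => E.
by apply: YZ; congr GCrit; apply: crit_inj; apply: comps_nbhd_inj YC _; rewrite -E.
Qed.

(** A nonprincipal ultrafilter concentrates on the components of one neighbourhood [Y], since [X]
    has finitely many subsets. There are then infinitely many such components, so [Y] is critical
    and is the limit. *)
Lemma gamma_compact X : compact [set: gamma X].
Proof.
rewrite compact_ultra => F FF _ /=.
have singl x : F [set x] -> [set: gamma X] `&` [set p | F --> p] !=set0.
  move=> Fx; exists x; split => //= A /nbhs_singleton Ax.
  by apply: filterS Fx => _ ->.
have [[C FC]|nFC] := pselect (exists C, F [set @GComp G X C]); first exact: singl FC.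
have nFfin (E : set (component X)) : finite_set E -> ~ F (@GComp G X @` E).
  move=> fE FE; apply: nFC.
  have [|C _ FC] := @ultra_finite_cover (gamma X) _ (fset_set E) (fun C => [set GComp C]) F FF.
    by rewrite fset_setK //; apply: filterS FE => _ [C EC <-]; exists C.
  by exists C.
(* The piece for [Y] holds the components with neighbourhood [Y] and, if [Y] is critical, its own
   point. *)
have [|Y] := @ultra_finite_cover (gamma X) _ (fpowerset X)
  (fun Y => @GComp G X @` comps_nbhd X Y `|` [set x | if x is GCrit Z then Y = Z else False])
  F FF.
  apply: filterS (@filterT _ F _) => -[C|Z] _ /=.
    have [Y YX YC] := comp_component_nbhd C.
    by exists Y; [rewrite /= fpowersetE|left; exists C].
  by exists (crit_set Z); [rewrite /= fpowersetE; exact: crit_sub|right].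
rewrite fpowersetE => YX FY.
have [FYc|FnY] := in_ultra_setVsetC (@GComp G X @` comps_nbhd X Y) FF; last first.
  have [[C|Z] [] [[D YD E]|YZ] nYC] := filter_ex (filterI FY FnY) => //.
    by case: nYC; exists D.
  apply: (@singl (GCrit Z)); apply: filterS (filterI FY FnY) => x [[Yx nYx //|]].
  by case: x => // W /= YW _; congr GCrit; apply: crit_inj; rewrite -YW.
have cY : critical Y by apply: (infinite_critical YX) => /nFfin.
exists (GCrit (CritIn YX cY)); split => //; apply: (subbase_cvg (@gamma_subbase G X)).
move=> _ [[CC ->] []//|[Z [CC [CCZ fCC] ->]] [[]//|[YZ]]].
have [FCC|FnCC] := in_ultra_setVsetC (@GComp G X @` CC) FF.
  by apply: filterS FCC => x; left.
case: (nFfin _ fCC); apply: filterS (filterI FYc FnCC) => _ [[C YC <-] nC].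
exists C => //; split; first by rewrite -YZ.
by move=> CCC; apply: nC; exists C.
Qed.

Lemma gamma_compactification X : is_compactification (@GComp G X).
Proof.
split; first exact: gamma_compact.
  split=> [C D [] //|O]; split=> [_|_]; last exact: open_component.
  exists (@GComp G X @` O); first exact: gamma_comp_open.
  by apply/seteqP; split=> [C OC|C [D OD [<-]] //]; exists C.
move=> O [[C|Y] Ox] oO; first by exists (GComp C); split => //; exists C.
have [CC [CCY fCC CCO]] := gamma_crit_nbhs oO Ox.
have [C CCC] : exists C, CC C.
  apply: contrapT => nC; apply: (critical_infinite (crit_sub Y) (@crit_crit _ _ Y)).
  by apply: sub_finite_set fCC => C YC; split => // CCC; apply: nC; exists C.
by exists (GComp C); split; [apply: CCO; exists C|exists C].
Qed.

(** The edge from [y] into [C] avoids [X], so [C] is absorbed by the component of [y]. Thus all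
    components with [y] in their neighbourhood have the same image. *)
Lemma comp_map_meets X' X (h : (X `<=` X')%fset) (C : component X') (D : component X) y :
  nbhd C y -> vset D y -> comp_map h C = D.
Proof.
move=> [_ [u Cu yu]] Dy; apply: (comp_map_eq h Cu).
rewrite (comp_reach Dy) /=; apply: reach1 yu (comp_notin Dy) _.
by apply: contra (comp_notin Cu); exact/fsubsetP.
Qed.

Lemma gamma_bond_crit_in X' X (h : (X `<=` X')%fset) (Y : crit_in X')
    (YX : (crit_set Y `<=` X)%fset) :
  gamma_bond h (GCrit Y) = GCrit (CritIn YX (@crit_crit _ _ Y)).
Proof.
rewrite /=; destruct (boolP (crit_set Y `<=` X)%fset) as [YX'|nYX].
  by congr GCrit; exact: crit_inj.
by have := YX; rewrite (negPf nYX).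
Qed.

Lemma gamma_bond_crit_out X' X (h : (X `<=` X')%fset) (Y : crit_in X') (D : component X) y :
  y \in crit_set Y -> vset D y -> gamma_bond h (GCrit Y) = GComp D.
Proof.
move=> yY Dy; rewrite /=; destruct (boolP (crit_set Y `<=` X)%fset) as [YX|nYX].
  by have := comp_notin Dy; rewrite (fsubsetP YX).
by congr GComp; exact: crit_comp_eq yY Dy.
Qed.

(** Near a critical set [Y] not inside [X] the map is constant: a vertex of [Y] outside [X] draws
    all components with neighbourhood [Y] into its own component. If [Y] lies inside [X], the map is
    injective on these components, so preimages of cofinite sets are cofinite. *)
Lemma gamma_bond_continuous X' X (h : (X `<=` X')%fset) : continuous (gamma_bond h).
Proof.
move=> [C|Y] A.
  move=> /nbhs_singleton AC.
  apply: filterS (open_nbhs_nbhs (conj (gamma_comp_open [set C]) _)); last by exists C.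
  by move=> _ [_ -> <-].
have oY (CC : set (component X')) : CC `<=` comps_nbhd X' Y ->
    finite_set (comps_nbhd X' Y `\` CC) ->
    nbhs (GCrit Y) (@GComp G X' @` CC `|` [set GCrit Y]).
  by move=> CCY fCC; apply: open_nbhs_nbhs; split; [exact: gamma_crit_open|right].
have [YX|/fsubsetPn[y yY yX]] := boolP (crit_set Y `<=` X)%fset; last first.
  have [D Dy] := comp_ex yX.
  have E := gamma_bond_crit_out h yY Dy; rewrite E => /nbhs_singleton AD.
  apply: filterS (oY (comps_nbhd X' Y) _ _) => //; last first.
    by rewrite setDv; exact: finite_set0.
  move=> _ [[C YC <-]|->]; rewrite /preimage /=; last by rewrite -/(gamma_bond h (GCrit Y)) E.
  by rewrite (comp_map_meets h _ Dy) // YC.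
rewrite (gamma_bond_crit_in h YX) nbhsE => -[O [oO OY] OA].
have [CC [CCY fCC CCO]] := gamma_crit_nbhs oO OY.
apply: filterS (oY (comps_nbhd X' Y `&` comp_map h @^-1` CC) _ _).
- move=> _ [[C [YC CCC] <-]|->]; apply: OA; first by apply: CCO; exists (comp_map h C).
  by rewrite gamma_bond_crit_in.
- by move=> C [].
have I : {in comps_nbhd X' Y &, injective (comp_map h)}.
  move=> C D /set_mem YC /set_mem YD E; apply: comp_inj.
  by rewrite -(comps_nbhd_map h YX YC).2 -(comps_nbhd_map h YX YD).2 E.
rewrite -(@eq_finite_set _ _ _ _ (@inj_card_eq _ _ _ (comp_map h) _)); last first.
  by move=> C D /set_mem[YC _] /set_mem[YD _]; apply: I; rewrite inE.
apply: sub_finite_set fCC => _ [C [YC nC] <-].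
split; first exact: (comps_nbhd_map h YX YC).1.
by move=> CCC; apply: nC.
Qed.

Lemma gamma_Csystem : is_Csystem (gamma_system (G := G)).
Proof.
split=> [X|X' X h]; last exact: gamma_bond_continuous.
by split; [exact: gamma_hausdorff|exact: gamma_compactification].
Qed.
End Gamma.

(** * Mapping an arbitrary system to the system of critical sets *)

Section LeastSystem.
Context {G : graph} (a : comp_system G).
Hypothesis aC : is_Csystem a.
Implicit Types X Y : {fset G}.

Let aH X : hausdorff_space (a X). Proof. exact: (aC.1 X).1. Qed.
Let aK X : is_compactification (ext_map (a X)). Proof. exact: (aC.1 X).2. Qed.
Let hI X : injective (ext_map (a X)). Proof. exact: embed_inj. Qed.

(** Neighbourhoods of components range over the finitely many subsets of [X], and closure commutes
    with finite unions, so density of the components puts [x] in the closure of one class. *)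
Lemma remainder_comps X x : ~ range (ext_map (a X)) x ->
  exists2 Y, (Y `<=` X)%fset & closure (ext_map (a X) @` comps_nbhd X Y) x.
Proof.
move=> nx; have [|Y] := @closure_finite_cover _ _ (fpowerset X)
  (fun Y => ext_map (a X) @` comps_nbhd X Y) x.
  have [_ _ dX] := aK X; move=> A Ax.
  have [||C AC] := range_comp_dense dX (O := A^°).
  - exact: open_interior.
  - by exists x.
  exists (ext_map (a X) C); split; last exact: interior_subset.
  have [Y YX YC] := comp_component_nbhd C.
  by exists Y; [rewrite /= fpowersetE|exists C].
by rewrite fpowersetE => YX; exists Y.
Qed.

(** A finite class has a finite, hence closed, image, whose closure contains no point outside the
    range. *)
Lemma remainder_critical X Y x : (Y `<=` X)%fset -> ~ range (ext_map (a X)) x ->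
  closure (ext_map (a X) @` comps_nbhd X Y) x -> critical Y.
Proof.
move=> YX nx cx; apply: (infinite_critical YX) => fY; apply: nx.
by move: cx; rewrite closure_finite_image // => -[C _ <-]; exists C.
Qed.

(* All components with neighbourhood [Z] send an edge to the same vertex of
   [Z `\` Y], so in [G - Y] they lie in a single component, whose image in [a Y]
   is isolated; the components with neighbourhood [Y] stay distinct there. *)
Lemma remainder_nbhd_sub X Y Z x : (Y `<=` X)%fset ->
  ~ range (ext_map (a X)) x ->
  closure (ext_map (a X) @` comps_nbhd X Y) x ->
  closure (ext_map (a X) @` comps_nbhd X Z) x -> (Z `<=` Y)%fset.
Proof.
move=> YX nx cY cZ; apply: contrapT => /negP/fsubsetPn[z zZ zY].
have [D Dz] := comp_ex zY.
have opD : open (bond YX @^-1` [set ext_map (a Y) D]).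
  by move/continuousP: (aC.2 _ _ YX); apply;
    exact: (embed_isolated (@open_component G Y) (@aH Y) (@aK Y)).
have clD : closed (bond YX @^-1` [set ext_map (a Y) D]).
  move/continuous_closedP: (aC.2 _ _ YX); apply.
  exact: accessible_closed_set1 (hausdorff_accessible (@aH Y)) _.
have xD : (bond YX @^-1` [set ext_map (a Y) D]) x.
  apply: clD; apply: closureS cZ => _ [C ZC <-] /=.
  by rewrite bond_map (comp_map_meets YX _ Dz) // ZC.
pose S := comps_nbhd X Y `&` comp_map YX @^-1` [set D].
have S1 : finite_set S.
  have [[C [YC CD]]|nS] := pselect (S !=set0); last first.
    by apply: sub_finite_set (@finite_set0 _) => C SC; apply: nS; exists C.
  apply: sub_finite_set (finite_set1 C) => E [YE ED]; apply: comp_inj.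
  rewrite -(comps_nbhd_map YX (fsubset_refl _) YE).2.
  by rewrite -(comps_nbhd_map YX (fsubset_refl _) YC).2 CD ED.
have : closure (ext_map (a X) @` S) x.
  move=> A Ax; have [_ [[C YC <-] [AC CD]]] := cY _ (filterI Ax (open_nbhs_nbhs (conj opD xD))).
  exists (ext_map (a X) C); split => //; exists C => //; split => //=.
  by apply: (@hI Y); rewrite -bond_map.
by rewrite closure_finite_image // => -[C _ hC]; apply: nx; exists C.
Qed.

Lemma remainder_nbhd_unique X Y Z x : (Y `<=` X)%fset -> (Z `<=` X)%fset ->
  ~ range (ext_map (a X)) x ->
  closure (ext_map (a X) @` comps_nbhd X Y) x ->
  closure (ext_map (a X) @` comps_nbhd X Z) x -> Y = Z.
Proof.
move=> YX ZX nx cY cZ; apply/eqP; rewrite eqEfsubset.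
by rewrite (remainder_nbhd_sub ZX nx cZ cY) (remainder_nbhd_sub YX nx cY cZ).
Qed.

(** At most one [g] is related to [x], by injectivity of the embedding and by
    [remainder_nbhd_unique], so the choice made in [to_gamma] is immaterial. *)
Definition to_gamma_rel X (x : a X) (g : gamma X) :=
  match g with
  | GComp C => x = ext_map (a X) C
  | GCrit Y => ~ range (ext_map (a X)) x /\
      closure (ext_map (a X) @` comps_nbhd X Y) x
  end.

Lemma to_gamma_subproof X (x : a X) : exists g, to_gamma_rel x g.
Proof.
have [[C _ <-]|nx] := pselect (range (ext_map (a X)) x); first by exists (GComp C).
have [Y YX cY] := remainder_comps nx.
by exists (GCrit (CritIn YX (remainder_critical YX nx cY))).
Qed.

Definition to_gamma X (x : a X) : gamma X := sval (cid (to_gamma_subproof x)).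

Lemma to_gammaP X (x : a X) : to_gamma_rel x (to_gamma x).
Proof. by rewrite /to_gamma; case: cid. Qed.

Lemma to_gamma_ext X (C : component X) : to_gamma (ext_map (a X) C) = GComp C.
Proof.
have := to_gammaP (ext_map (a X) C); case: to_gamma => [D /hI -> //|Y [[]]].
by exists C.
Qed.

(** The preimage of a basic neighbourhood of [Y] is the open image of [CC] together with the points
    outside the closure of the components of other neighbourhoods, up to finitely many components
    with neighbourhood [Y], which form a closed set. *)
Lemma to_gamma_continuous X : continuous (@to_gamma X).
Proof.
apply: (subbase_continuous (@gamma_subbase G X)) => A.
have compE (CC : set (component X)) :
    @to_gamma X @^-1` (@GComp G X @` CC) = ext_map (a X) @` CC.
  apply/seteqP; split=> [x [C CCC Cx]|_ [C CCC <-]]; exists C => //.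
    by have := to_gammaP x; rewrite -Cx => ->.
  by rewrite to_gamma_ext.
have compO (CC : set (component X)) : open (ext_map (a X) @` CC).
  exact: (embed_image_open (@open_component G X) (@aH X) (@aK X)).
move=> [[CC ->]|[Y [CC [CCY fCC] ->]]]; first by rewrite compE.
rewrite preimage_setU compE.
suff -> : ext_map (a X) @` CC `|` @to_gamma X @^-1` [set GCrit Y] =
    ext_map (a X) @` CC `|` (~` closure (ext_map (a X) @` (~` comps_nbhd X Y))
      `&` ~` (ext_map (a X) @` (comps_nbhd X Y `\` CC))).
  apply: openU => //; apply: openI; first by rewrite openC; exact: closed_closure.
  rewrite openC -closure_finite_image //; exact: closed_closure.
apply/seteqP; split=> x [Cx|Yx]; [by left| |by left| ]; last first.
  have [nYx nCx] := Yx; have := to_gammaP x.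
  case E : (to_gamma x) => [C|Z] /=.
    move=> xC; left; exists C => //; apply: contrapT => nCC.
    have [YC|nYC] := pselect (comps_nbhd X Y C); first by apply: nCx; exists C.
    by apply: nYx; apply: subset_closure; exists C.
  move=> [nx cx]; right; rewrite /= E; congr GCrit.
  apply: crit_inj; apply: contrapT => ZY; apply: nYx.
  apply: closureS cx => _ [C ZC <-]; exists C => // YC; apply: ZY.
  exact: comps_nbhd_inj ZC YC.
right; have := to_gammaP x; rewrite Yx /= => -[nx cx].
split; last by move=> [C _ Cx]; apply: nx; exists C.
move=> cnx.
(* The components with a neighbourhood other than [Y] fall into finitely many classes. Were [x] in
   the closure of their union, it would be in the closure of one class, against uniqueness of the
   neighbourhood. *)
have [|Z] := @closure_finite_cover _ _ (fpowerset X `\ crit_set Y)%fset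
  (fun Y => ext_map (a X) @` comps_nbhd X Y) x.
  apply: closureS cnx => _ [C nYC <-]; have [Z ZX ZC] := comp_component_nbhd C.
  exists Z; last by exists C.
  rewrite /= !inE fpowersetE ZX andbT; apply/eqP => ZY; apply: nYC.
  by rewrite -ZY.
rewrite !inE fpowersetE => /andP[/eqP ZY ZX] cZ; apply: ZY.
exact: (remainder_nbhd_unique ZX (crit_sub Y) nx cZ cx).
Qed.

Lemma to_gamma_bond X' X (h : (X `<=` X')%fset) x :
  to_gamma (bond h x) = gamma_bond h (to_gamma x).
Proof.
have [_ _ dX] := aK X'; move: x.
apply: (dense_continuous_eq (@gamma_hausdorff G X) _ _ dX) => [x|x|_ [C _ <-]].
- apply: continuous_comp; [exact: aC.2|exact: to_gamma_continuous].
- apply: continuous_comp; [exact: to_gamma_continuous|exact: gamma_bond_continuous].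
by rewrite bond_map !to_gamma_ext.
Qed.

Lemma to_gamma_morphism X :
  ext_morphism (@to_gamma X : a X -> gamma_system X).
Proof. by split; [exact: to_gamma_continuous|exact: to_gamma_ext]. Qed.

Lemma Cle_gamma : Cle gamma_system a.
Proof.
exists (@to_gamma); split; [exact: to_gamma_morphism|exact: to_gamma_bond].
Qed.

End LeastSystem.

(** * Compactifications induced by systems *)

Section EdgePoints.
Context (R : realType) {G : graph}.
Implicit Types (X : {fset G}) (e : edge G).

Lemma compact_unit_segment : @compact R^o [set x : R | (0 <= x <= 1)%R].
Proof. by have := @segment_compact R 0%R 1%R; rewrite set_itvcc. Qed.

Lemma open_ltR (x : R) : @open R^o [set y : R | (y < x)%R].
Proof. exact: (@open_lt R x). Qed.

Lemma open_gtR (x : R) : @open R^o [set y : R | (x < y)%R].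
Proof. exact: (@open_gt R x). Qed.

Lemma half_itv_subproof : (0 < (2%:R^-1 : R) < 1)%R.
Proof. by rewrite invr_gt0 ltr0n invf_lt1 ?ltr0n // ltr1n. Qed.

(** The value one half is an arbitrary choice that fixes one open star at each vertex. *)
Definition half_itv : unit_itv R := exist _ (2%:R^-1)%R half_itv_subproof.

Definition half_star (v : G) : set (gpoint R G) := open_star v (fun _ => half_itv).

Lemma open_star_open (v : G) i : open (open_star v i : set (gpoint R G)).
Proof. by apply: (subbase_open (@gpoint_subbase R G)); left; exists v, i. Qed.

Lemma open_segment_open e (U : set R) : @open R^o U ->
  open (open_segment e U : set (gpoint R G)).
Proof. by move=> oU; apply: (subbase_open (@gpoint_subbase R G)); right; exists e, U. Qed.

Lemma edge_other_end e z : z \in val e -> exists2 w, val e = [fset z; w] & z != w.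
Proof.
move=> ze; have := edges_card (valP e); rewrite (cardfsD1 z) ze add1n => -[] /eqP.
move=> /cardfs1P[w ew]; exists w; first by rewrite -(fsetD1K ze) ew.
by have : w \in (val e `\ z)%fset; [rewrite ew inE|rewrite !inE eq_sym => /andP[]].
Qed.

(** For edges, one end in [C] is enough: this covers at once the edges inside [C] and those between
    [X] and [C]. *)
Definition in_comp X (C : component X) (p : gpoint R G) : Prop :=
  match p with
  | Vertex v => vset C v
  | Inner e _ => exists2 x, x \in val e & vset C x
  end.

Lemma in_comp_unique X (C D : component X) p : in_comp C p -> in_comp D p -> C = D.
Proof.
case: p => [v|e t] /=; first exact: comp_eq.
move=> [x xe Cx] [y ye Dy]; have [w ew xw] := edge_other_end xe.
move: ye; rewrite ew !inE => /orP[/eqP yx|/eqP yw].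
  by apply: comp_eq Cx _; rewrite -yx.
apply: (comp_eq Cx); rewrite (comp_reach Dy) /= yw; apply: reach_sym.
apply: reach1; last by rewrite -yw; exact: comp_notin Dy.
  by rewrite /adj -ew; exact: valP.
exact: comp_notin Cx.
Qed.

Lemma in_comp_map X' X (h : (X `<=` X')%fset) (C : component X') p :
  in_comp C p -> in_comp (comp_map h C) p.
Proof.
by case: p => [v|e t] /=; [exact: comp_map_sub|case=> x xe Cx; exists x => //;
  exact: comp_map_sub Cx].
Qed.

Lemma region_in_comp X (CC : set (component X)) p :
  region CC p <-> exists2 C, CC C & in_comp C p.
Proof.
case: p => [v|e t] /=; first by split=> -[C CCC Cv]; exists C.
split=> [[[C CCC eC]|[x [y [xX [C CCC Cy] exy]]]]|[C CCC [z ze Cz]]].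
- by exists C => //; exists (edge_tail e); [|apply: eC]; rewrite /edge_tail /=; case: cid.
- by exists C => //; exists y => //; rewrite exy !inE eqxx orbT.
have [w ew zw] := edge_other_end ze.
have [wX|wX] := boolP (w \in X).
  by right; exists w, z; split => //; [exists C|rewrite ew fsetUC].
left; exists C => // y; rewrite /= ew !inE => /orP[/eqP->//|/eqP->].
rewrite (comp_reach Cz) /=; apply: reach1 (comp_notin Cz) wX.
by rewrite /adj -ew; exact: valP.
Qed.

Lemma region_open X (CC : set (component X)) : open (region CC : set (gpoint R G)).
Proof.
have -> : region CC = \bigcup_(v in comps_verts CC) (half_star v `|`
    \bigcup_(e in [set e : edge G | v \in val e]) open_segment e (@setT R)).
  apply/seteqP; split=> [p /region_in_comp[C CCC]|p [v [C CCC Cv] vp]].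
    case: p => [v|e t] /= => [Cv|[x xe Cx]].
      by exists v; [exists C|left].
    by exists x; [exists C|right; exists e].
  apply/region_in_comp; exists C => //; case: p vp => [u|e t] [] /=.
  - by move=> ->.
  - by case=> ? _.
  - by case=> ve _; exists v.
  - by case=> e' ve' [ee' _]; exists v => //; rewrite ee'.
apply: bigcup_open => v _; apply: openU; first exact: open_star_open.
by apply: bigcup_open => e _; apply: open_segment_open; exact: openT.
Qed.

End EdgePoints.

(** * Adding limit points to the 1-complex *)

Section LimitSpace.
Context (R : realType) {G : graph} (L : Type) (B : limit_basis G L).
Notation K := (add_limits R B).
Notation Pt := (@Pt R G L B).
Notation Lim := (@Lim R G L B).

Lemma limit_basic_open X (CC : set (component X)) S : B CC S ->
  open (Pt @` region CC `|` Lim @` S : set K).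
Proof.
by move=> BS; apply: (subbase_open (@add_limits_subbase R G L B)); right; exists X, CC, S.
Qed.

Lemma Pt_image_open (U : set (gpoint R G)) : open U -> open (Pt @` U : set K).
Proof. by move=> oU; apply: (subbase_open (@add_limits_subbase R G L B)); left; exists U. Qed.

Lemma Pt_continuous : continuous (Pt : gpoint R G -> K).
Proof.
apply: (subbase_continuous (@add_limits_subbase R G L B)) => _ [[U oU ->]|[X [CC [S _ ->]]]].
  suff -> : Pt @^-1` (Pt @` U) = U by [].
  by apply/seteqP; split=> [p [q Uq [<-]]//|p Up]; exists p.
suff -> : Pt @^-1` (Pt @` region CC `|` Lim @` S : set K) = region CC by exact: region_open.
apply/seteqP; split=> [p [[q CCq [<-]]//|[l _ //]]|p CCp]; left; by exists p.
Qed.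

Lemma inner_edges_open : open (@inner_edges R G L B).
Proof.
have -> : (@inner_edges R G L B) =
    \bigcup_(e in [set: edge G]) (Pt @` open_segment e (@setT R)).
  apply/seteqP; split=> [_ [e [t ->]]|_ [e _ [[v|e' t] //= _ <-]]].
    by exists e => //; exists (Inner e t).
  by exists e', t.
apply: bigcup_open => e _; apply: Pt_image_open; apply: open_segment_open.
exact: openT.
Qed.

(** A filter concentrated on [G] can be pulled back to the 1-complex, so only the subbasic sets
    there have to be tested. *)
Lemma Pt_cvg (F : set_system K) (p : gpoint R G) : Filter F -> F (range Pt) ->
  (forall A, gpoint_basic A -> A p -> F (Pt @` A)) -> F --> (Pt p : K).
Proof.
move=> FF FPt FA O.
rewrite nbhsE => -[W [oW Wp] WO]; apply: filterS WO _.
pose F' : set_system (gpoint R G) := [set A | F (Pt @` A)].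
have FF' : Filter F'.
  split=> [//|A A'|A A' AA']; rewrite /F' /=.
    move=> FA1 FA2; apply: filterS (filterI FA1 FA2) => _ [[q Aq <-] [q' A'q' [qq']]].
    by exists q => //; split => //; rewrite -qq'.
  by apply: filterS => _ [q Aq <-]; exists q => //; exact: AA'.
have : F' (Pt @^-1` W).
  have cF : F' --> p by apply: (subbase_cvg (@gpoint_subbase R G)).
  apply: cF; apply: open_nbhs_nbhs; split => //.
  by move/continuousP: Pt_continuous; apply.
by rewrite /F' /=; apply: filterS => _ [q Wq <-].
Qed.

Lemma vertex_nbhs (v : G) : nbhs (Pt (Vertex v) : K) (Pt @` half_star v).
Proof.
apply: open_nbhs_nbhs; split; last by exists (Vertex v).
by apply: Pt_image_open; exact: open_star_open.
Qed.

(** The parameter converges to some [s] in the closed unit interval. For [s] equal to 0 or 1 the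
    filter converges to an end of the edge, otherwise to the inner point at [s]. *)
Lemma edge_compact (F : set_system K) e : UltraFilter F -> F (Pt @` range (Inner e)) ->
  exists p : K, F --> p.
Proof.
move=> FF Fe.
(* The value 0 off the inner edge points is a dummy, because [F] contains the set of inner points of
   [e]. *)
pose param (x : K) : R^o := if x is Defs.Pt (Inner _ t) then val t else 0%R.
have UU := ultraP (ultra_map param (Ultra FF)).
have := @compact_unit_segment R; rewrite compact_ultra => /(_ _ UU) cs.
have [|s [/andP[s0 s1] Fs]] := cs.
  apply: (@filterS _ F _ _ _ _ Fe) => _ [_ [t _ <-] <-] /=.
  by have /andP[t0 t1] := valP t; rewrite !ltW.
have Fopen (A : set R^o) : open A -> A s -> F (Pt @` (open_segment e A)).
  move=> oA As; have : F (param @^-1` A) := Fs _ (open_nbhs_nbhs (conj oA As)).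
  move=> /(filterI Fe); apply: filterS => _ [[_ [t _ <-] <-] At].
  by exists (Inner e t).
have FPt : F (range Pt) by apply: filterS Fe => _ [p _ <-]; exists p.
have [s_pos|s_neg|s00] := ltgtP 0%R s; last first.
- exists (Pt (Vertex (edge_tail e))); apply: Pt_cvg => // _ [[v [i ->]]|[e' [U oU ->]]] //=.
  move=> tv; have := Fopen _ (@open_ltR R (val (i e))).
  rewrite /= -s00 => /(_ (andP (valP (i e))).1); apply: filterS => _ [[//|e' t] [-> te] <-].
  exists (Inner e t) => //=; split; last by rewrite -tv eqxx.
  by rewrite -tv /edge_tail; case: cid.
- by move: s_neg; rewrite ltNge s0.
have [s_lt|s_neg|s11] := ltgtP s 1%R; last first.
- have te : edge_tail e \in val e by rewrite /edge_tail; case: cid.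
  have [w ew tw] := edge_other_end te.
  exists (Pt (Vertex w)); apply: Pt_cvg => // _ [[v [i ->]]|[e' [U oU ->]]] //=.
  move=> wv; have := Fopen _ (@open_gtR R (val (i e))).
  rewrite /= s11 => /(_ (andP (valP (i e))).2); apply: filterS => _ [[//|e' t] [-> et] <-].
  exists (Inner e t) => //=; split; first by rewrite -wv ew !inE eqxx orbT.
  by rewrite -wv eq_sym (negPf tw).
- by move: s_neg; rewrite ltNge s1.
have s01 : (0 < s < 1)%R by rewrite s_pos.
exists (Pt (Inner e (exist _ s s01))); apply: Pt_cvg => // _ [[v [i ->]]|[e' [U oU ->]]] /=.
  case=> ve; case: ifP => vt si.
    apply: filterS (Fopen _ (@open_ltR R (val (i e))) si) => _ [[//|e' t] [-> te] <-].
    by exists (Inner e t) => //=; rewrite vt.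
  apply: filterS (Fopen _ (@open_gtR R (val (i e))) si) => _ [[//|e' t] [-> te] <-].
  by exists (Inner e t) => //=; rewrite vt.
by move=> [ee' Us]; rewrite -ee'; exact: Fopen.
Qed.

End LimitSpace.

(** * The space induced by a system *)

Section Induced.
Context (R : realType) {G : graph} (a : comp_system G).
Hypothesis aC : is_Csystem a.
Implicit Types X : {fset G}.
Notation K := (add_limits R (sys_basis (a := a))).
Notation Pt := (@Pt R G _ (sys_basis (a := a))).
Notation Lim := (@Lim R G _ (sys_basis (a := a))).

Lemma invlim_ext (x y : invlim a) : (forall X, x X = y X) -> x = y.
Proof.
case: x y => [x xP] [y yP] /= xy.
have E : x = y by apply: functional_extensionality_dep.
by move: xP; rewrite E => xP; rewrite (Prop_irrelevance xP yP).
Qed.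

(* For open [A] these are the basic open neighbourhoods of limit points. *)
Definition lim_nbhd X (A : set (a X)) : set K :=
  [set p : K | match p with
   | Defs.Pt q => exists2 C, A (ext_map (a X) C) & in_comp C q
   | Defs.Lim l => A (l X)
   end].

Lemma lim_nbhdE X (A : set (a X)) : lim_nbhd A =
  Pt @` region (ext_map (a X) @^-1` A) `|` Lim @` [set l : invlim a | A (l X)].
Proof.
apply/seteqP; split=> [[q|l] /=|_ [[q /region_in_comp qA <-]|[l Al <-]] //].
  by move=> qA; left; exists q => //; apply/region_in_comp.
by move=> Al; right; exists l.
Qed.

Lemma lim_nbhd_open X (A : set (a X)) : open A -> open (lim_nbhd A).
Proof. by move=> oA; rewrite lim_nbhdE; apply: limit_basic_open; exists A. Qed.

Lemma lim_nbhd_bond X' X (h : (X `<=` X')%fset) (A : set (a X)) :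
  lim_nbhd (bond h @^-1` A) `<=` lim_nbhd A.
Proof.
move=> [q|l] /=; last by rewrite lim_coordP.
by move=> [C AC Cq]; exists (comp_map h C); [rewrite -bond_map|exact: in_comp_map].
Qed.

Lemma lim_nbhdI X (A B : set (a X)) : lim_nbhd A `&` lim_nbhd B `<=` lim_nbhd (A `&` B).
Proof.
move=> [q|l] //= [[C AC Cq] [D BD Dq]]; exists C => //.
by split => //; rewrite (in_comp_unique Cq Dq).
Qed.

Lemma lim_nbhdS X (A B : set (a X)) : A `<=` B -> lim_nbhd A `<=` lim_nbhd B.
Proof. by move=> AB [q [C AC Cq]|l /AB //]; exists C => //; exact: AB. Qed.

(** Neighbourhoods over different finite sets [X] and [Y] are pulled back along the bonding maps to
    their union and intersected there. *)
Lemma lim_nbhd_base (O : set K) (l : invlim a) : open O -> O (Lim l) ->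
  exists X (A : set (a X)), [/\ open A, A (l X) & lim_nbhd A `<=` O].
Proof.
move=> oO; move: l; pattern O; apply: (subbase_ind (@add_limits_subbase R G _ _) _ _ _ _ oO).
- by move=> l _; exists fset0, setT; split => //; exact: openT.
- move=> O1 O2 H1 H2 l [/H1[X [A [oA Al AO1]]] /H2[Y [B [oB Bl BO2]]]].
  have hX := fsubsetUl X Y; have hY := fsubsetUr X Y.
  exists (X `|` Y)%fset, (bond hX @^-1` A `&` bond hY @^-1` B); split.
  + by apply: openI; [move/continuousP: (aC.2 _ _ hX)|move/continuousP: (aC.2 _ _ hY)]; apply.
  + by split; rewrite /= lim_coordP.
  + move=> p Wp; split; [apply: AO1|apply: BO2].
      by apply: (lim_nbhd_bond (h := hX)); apply: lim_nbhdS Wp => x [].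
    by apply: (lim_nbhd_bond (h := hY)); apply: lim_nbhdS Wp => x [].
- move=> F FP l [W FW /(FP _ FW)[X [A [oA Al AW]]]].
  by exists X, A; split => // p /AW Wp; exists W.
- move=> _ [[U _ ->] l [? _ //]|[X [CC [S [A oA [-> ->]] ->]]] l].
  move=> [[? _ //]|[l' Al' [E]]]; exists X, A.
  by split; rewrite ?lim_nbhdE // -E.
Qed.

(** Components are dense in [a X]. This gives density of the embedded space and later surjectivity
    of the induced maps. *)
Lemma lim_nbhd_vertex (O : set K) (l : invlim a) : open O -> O (Lim l) ->
  exists v, O (Pt (Vertex v)).
Proof.
move=> oO /(lim_nbhd_base oO)[X [A [oA Al AO]]].
have [||C AC] := range_comp_dense (let: conj _ (And3 _ _ d) := aC.1 X in d) (O := A).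
- by [].
- by exists (l X).
have [v Cv] := comp_nonempty C; exists v; apply: AO; by exists C.
Qed.

(** The complement consists of finitely many vertices and the inner points of finitely many edges,
    because graphs are simple. Compactness rests on this. *)
Lemma lim_nbhdT_compl X : ~` lim_nbhd [set: a X] =
  [set p : K | match p with
   | Defs.Pt (Vertex v) => v \in X
   | Defs.Pt (Inner e _) => (val e `<=` X)%fset
   | Defs.Lim _ => False
   end].
Proof.
apply/seteqP; split=> [[[v|e t]|l] /=|[[v|e t]|l] //=].
- move=> nv; apply: contrapT => /negP/comp_ex[C Cv]; apply: nv; by exists C.
- move=> ne; apply: contrapT => /negP/fsubsetPn[z ze /comp_ex[C Cz]].
  by apply: ne; exists C => //; exists z.
- by move=> H; apply: H.
- by move=> vX [C _ /comp_notin]; rewrite vX.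
- by move=> /fsubsetP eX [C _ [z /eX zX /comp_notin]]; rewrite zX.
Qed.

Lemma induced_compact : compact [set: K].
Proof.
rewrite compact_ultra => F FF _ /=.
suff [p Fp] : exists p : K, F --> p by exists p.
have [[v Fv]|nFv] := pselect (exists v, F [set Pt (Vertex v)]).
  exists (Pt (Vertex v)) => A /nbhs_singleton Av.
  by apply: filterS Fv => _ ->.
have [[e Fe]|nFe] := pselect (exists e, F (Pt @` range (Inner e))).
  exact: edge_compact Fe.
(* [F] concentrates on no vertex and no edge, hence on the components of [G - X]
   and the limit points, and so it induces an ultrafilter on [a X]. *)
have FT X : F (lim_nbhd [set: a X]).
  have [//|] := in_ultra_setVsetC (lim_nbhd [set: a X]) FF.
  rewrite lim_nbhdT_compl => FX; exfalso.
  have FX' : F ((\bigcup_(v in [set` X]) [set Pt (Vertex v)]) `|`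
      \bigcup_(Y in [set` fpowerset X])
        [set p | exists e t, p = Pt (Inner e t) /\ val e = Y]).
    apply: filterS FX => -[[v|e t]|//] /= vX; [left|right]; first by exists v.
    by exists (val e); [rewrite /= fpowersetE|exists e, t].
  have [F1|F1] := in_ultra_setVsetC (\bigcup_(v in [set` X]) [set Pt (Vertex v)]) FF.
    by have [v vX Fv] := ultra_finite_cover FF F1; apply: nFv; exists v.
  have /(ultra_finite_cover FF)[Y _ FY] : F (\bigcup_(Y in [set` fpowerset X])
        [set p | exists e t, p = Pt (Inner e t) /\ val e = Y]).
    by apply: filterS (filterI FX' F1) => p [[]].
  (* An edge is determined by its vertex set, so the points indexed by [Y] lie on a single edge. *)
  have [_ [e [t [_ eY]]]] := filter_ex FY.
  apply: nFe; exists e; apply: filterS FY => _ [e' [t' [-> e'Y]]].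
  by exists (Inner e' t') => //; exists t' => //; congr Inner; apply: val_inj; rewrite e'Y.
pose GF X : set_system (a X) := [set A | F (lim_nbhd A)].
have GX X : UltraFilter (GF X).
  rewrite /GF; apply: ultra_dichotomy => [||A] /=.
  - split=> /=; first exact: FT.
      move=> A B; rewrite /= => FA FB.
      exact: (@filterS _ F _ _ _ (@lim_nbhdI X A B) (filterI FA FB)).
    by move=> A B AB; rewrite /=; apply: filterS; exact: lim_nbhdS.
  - rewrite (_ : lim_nbhd _ = set0); first exact: filter_not_empty.
    by rewrite -subset0 => -[q [C []]|l []].
  - have [|FnA] := in_ultra_setVsetC (lim_nbhd A) FF; [by left|right].
    apply: filterS (filterI FnA (FT X)) => -[q|l] [/= nA] //.
    by move=> [C _ Cq]; exists C => // AC; apply: nA; exists C.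
have lX X : exists p : a X, GF X --> p.
  have [_ [cX _ _]] := aC.1 X; move: cX; rewrite compact_ultra.
  by move=> /(_ _ (GX X)) cX; have [|p [_ ?]] := cX; [exact: FT|exists p].
pose l X : a X := sval (cid (lX X)).
have lP X (A : set (a X)) : open A -> A (l X) -> F (lim_nbhd A).
  move=> oA Al; have H : GF X --> l X.
    by rewrite /l; case: cid.
  exact: (H A (open_nbhs_nbhs (conj oA Al))).
(* Disjoint neighbourhoods of two incompatible limits would give disjoint members of [F]. *)
have lB X' X (h : (X `<=` X')%fset) : bond h (l X') = l X.
  apply: contrapT => /(hausdorff_sep (aC.1 X).1)[U [V [oU oV Ul Vl UV]]].
  have oU' : open (bond h @^-1` U) by move/continuousP: (aC.2 _ _ h); apply.
  have [p [/lim_nbhd_bond pU pV]] := filter_ex (filterI (lP _ _ oU' Ul) (lP _ _ oV Vl)).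
  have := lim_nbhdI (conj pU pV).
  by rewrite UV; case: p {pU pV} => [q [C []]|].
exists (Lim (InvLim lB)); apply: (subbase_cvg (@add_limits_subbase R G _ _)).
move=> _ [[U _ ->] [? _ //]|[X [CC [S [A oA [-> ->]] ->]]]].
rewrite -lim_nbhdE => Al; exact: lP.
Qed.

Lemma star_vertex (v u : G) : (Pt @` half_star v : set K) (Pt (Vertex u)) -> u = v.
Proof. by move=> [[w|//] wv [<-]]. Qed.

(** Against a limit point take the finite set consisting of [v] alone: its components miss [v], so
    they share with the star of [v] only inner points of edges. *)
Lemma vertex_sep (v : G) (q : K) : ~ inner_edges q -> Pt (Vertex v) <> q ->
  exists U V, [/\ open U, open V, U (Pt (Vertex v)), V q & U `&` V `<=` @inner_edges R G _ _].
Proof.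
move=> nq vq; exists (Pt @` half_star v).
have o1 (w : G) : open (Pt @` half_star w).
  by apply: Pt_image_open; exact: open_star_open.
case: q nq vq => [[u|e t]|l] nq vq; last 2 first.
- by case: nq; exists e, t.
- exists (lim_nbhd [set: a [fset v]%fset]); split => //.
  + exact: lim_nbhd_open openT.
  + by exists (Vertex v).
  + move=> [[u|e t]|m]; [|by move=> _; exists e, t|by move=> [[]]].
    by move=> [/star_vertex -> [C _ /comp_notin]]; rewrite inE eqxx.
- exists (Pt @` half_star u); split => //.
  + by exists (Vertex v).
  + by exists (Vertex u).
  + move=> [[w|e t]|m]; [|by move=> _; exists e, t|by move=> [[]]].
    by move=> [/star_vertex -> /star_vertex uv]; case: vq; rewrite uv.
Qed.

(** Distinct limit points differ in some coordinate, where the Hausdorff space [a X] separates them;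
    all other cases involve a vertex. *)
Lemma induced_sep (p q : K) : ~ inner_edges p -> ~ inner_edges q -> p <> q ->
  exists U V, [/\ open U, open V, U p, V q & U `&` V `<=` @inner_edges R G _ _].
Proof.
case: p q => [[v|e t]|l] q; [by move=> _; exact: vertex_sep|by case; exists e, t|].
case: q => [[v|e t]|m]; [|by move=> _ []; exists e, t|].
  move=> nl nv /nesym/(vertex_sep nl)[U [V [oU oV Uv Vl UV]]].
  by exists V, U; split => //; rewrite setIC.
move=> _ _ lm; have [X lmX] : exists X, l X <> m X.
  apply: contrapT => nX; apply: lm; congr Defs.Lim; apply: invlim_ext => X.
  by apply: contrapT => lmX; apply: nX; exists X.
have [U [V [oU oV Ul Vm UV]]] := hausdorff_sep (aC.1 X).1 lmX.
exists (lim_nbhd U), (lim_nbhd V); split; rewrite //; try exact: lim_nbhd_open.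
by move=> p /lim_nbhdI; rewrite UV; case: p => [q [C []]|].
Qed.

Lemma end_lim_inj : injective (@end_lim G a).
Proof.
move=> w w' E; have Ecomp X : end_comp X w = end_comp X w'.
  apply: (embed_inj (aC.1 X).2).
  by have := congr1 (fun l : invlim a => l X) E.
have sub (u u' : graph_end G) : (forall X, end_comp X u = end_comp X u') ->
    end_rays u `<=` end_rays u'.
  move=> uu' s us; have [r rr Er] := end_raysP u.
  have [r' rr' Er'] := end_raysP u'.
  have u'r' : end_rays u' r' by rewrite Er'; split => // X; have [C] := ray_tail X rr'; exists C.
  rewrite Er'; split; first by move: us; rewrite Er => -[].
  move=> X; exists (end_comp X u'); split; first exact: end_comp_tail.
  by rewrite -uu'; exact: end_comp_tail.
have : end_rays w = end_rays w' by apply/seteqP; split; apply: sub.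
case: (w) (w') => [A pA] [B pB] /= AB; move: pA; rewrite AB => pA.
by rewrite (Prop_irrelevance pA pB).
Qed.

Lemma Lim_inj : injective Lim. Proof. by move=> l m []. Qed.

(** A basic neighbourhood of ends is given by an arbitrary set of components. As [a X] embeds the
    discrete space of components, that set is the trace of an open set of [a X]. *)
Lemma induced_embedding : embedding (ext_map (induced R a)).
Proof.
split=> [[p|w] [q|w'] //=|O]; first by case=> ->.
  by move=> /Lim_inj/end_lim_inj ->.
split=> [oO|[U oU ->]].
  move: O oO; apply: (subbase_ind (@add_limits_subbase R G _ _)).
  - by exists setT => //; exact: openT.
  - move=> _ _ [U oU ->] [V oV ->]; exists (U `&` V) => //; exact: openI.
  - move=> F FP; exists (\bigcup_(U in [set U : set K | open U /\
        F (ext_map (induced R a) @^-1` U)]) U).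
      by apply: bigcup_open => U [].
    apply/seteqP; split=> [x [A FA Ax]|x [U [oU FU] Ux]];
      last by exists (ext_map (induced R a) @^-1` U).
    by have [U oU AU] := FP _ FA; exists U; rewrite /= -?AU //; move: Ax; rewrite AU.
  - move=> _ [[U oU ->]|[X [CC [S -> ->]]]].
      exists (Pt @` U); first exact: Pt_image_open.
      by apply/seteqP; split=> [_ [p Up <-]|[p [q Uq [<-]]|w [q _ //]]]; [exists p|exists q].
    have [_ [_ [_ oX] _]] := aC.1 X.
    have [A oA CCA] := (oX CC).1 (@open_component G X CC).
    exists (lim_nbhd A); first exact: lim_nbhd_open.
    rewrite lim_nbhdE -CCA; apply/seteqP; split.
      move=> _ [[p Cp <-]|[w Cw <-]]; [left; by exists p|right].
      exists (end_lim a w) => //=; by move: Cw; rewrite /= CCA.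
    move=> [p|w] [[q Cq E]|[l Al E]] //.
      by left; exists q => //; case: E => ->.
    by right; exists w => //=; rewrite CCA /=; move/Lim_inj: E Al => ->.
have cE : continuous (ext_map (induced R a)).
  apply: (subbase_continuous (@add_limits_subbase R G _ _)).
  move=> _ [[V oV ->]|[X [CC [S [A oA [-> ->]] ->]]]].
    rewrite (_ : _ @^-1` _ = Defs.Pt @` V); first exact: Pt_image_open.
    by apply/seteqP; split=> [[p [q Vq [<-]]|w [q _ //]]|_ [p Vp <-]]; [exists q|exists p].
  rewrite (_ : _ @^-1` _ = Defs.Pt @` region (ext_map (a X) @^-1` A) `|`
     Defs.Lim @` [set w | (ext_map (a X) @^-1` A) (end_comp X w)]).
    exact: limit_basic_open.
  apply/seteqP; split; last first.
    by move=> _ [[p Cp <-]|[w Cw <-]]; [left; exists p|right; exists (end_lim a w)].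
  move=> [p|w] [[q Cq E]|[l Al E]] //; first by left; exists q => //; case: E => ->.
  by right; exists w => //=; move/Lim_inj: E Al => ->.
by move/continuousP: cE; apply.
Qed.

End Induced.

(** * Hausdorff compactifications away from the inner edge points *)

Section OmegaCriterion.
Context (R : realType) {G : graph}.
Implicit Types K : extension (ends_space R G).
Local Notation E := (@inner_edges R G _ (@end_basis G)).

Definition no_edges K : set K := ~` (ext_map K @` E).

Arguments no_edges : clear implicits.

(* A form of [is_Omega_compactification] without subtypes, which is easy to
   transport along homeomorphisms. *)
Definition Omega_criterion K := [/\ is_compactification (ext_map K),
  closed (no_edges K),
  forall p q, no_edges K p -> no_edges K q -> p <> q ->
    exists U V, [/\ open U, open V, U p, V q & U `&` V `<=` ~` no_edges K] &
  forall O : set K, open O -> O `&` no_edges K !=set0 ->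
    exists2 x, ~ E x & O (ext_map K x)].

Lemma criterion_Omega K : Omega_criterion K -> is_Omega_compactification K.
Proof.
move=> [cK clH sepH dH]; split => //=.
have hP (x : ~` E) : ext_map K (val x) \in ~` (ext_map K @` E).
  rewrite inE => -[y Ey yx]; have := set_valP x; apply.
  by have [_ [hI _] _] := cK; rewrite -(hI _ _ yx).
pose h (x : ~` E) : ~` (ext_map K @` E) :=
  exist (fun y => y \in ~` (ext_map K @` E)) (ext_map K (val x)) (hP x).
exists h; split => //.
  apply: hausdorffP => p q pq.
  have [|U [V [oU oV Up Vq UV]]] := sepH (val p) (val q) (set_valP p) (set_valP q).
    by move=> /val_inj.
  exists (val @^-1` U), (val @^-1` V); split => //; [by exists U|by exists V|].
  by rewrite -subset0 => x [Ux Vx]; case: (UV (val x)) => //; exact: set_valP.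
have [cT [hI hO] _] := cK; split.
- apply: set_type_compact; exact: (subclosed_compact clH cT).
- split; first by move=> x y /(congr1 val)/hI; exact: val_inj.
  move=> O; split=> [[W oW <-]|[_ [U oU <-] ->]].
    have [U oU ->] := (hO W).1 oW.
    by exists (val @^-1` U); first by exists U.
  by exists (ext_map K @^-1` U) => //; apply/hO; exists U.
- move=> O [x Ox] [U oU UO].
  have [|y nEy Uy] := dH U oU.
    exists (val x); split; first by rewrite -UO in Ox.
    exact: set_valP.
  exists (h (exist _ y (mem_set nEy))); split; last by exists (exist _ y (mem_set nEy)).
  by rewrite -UO.
Qed.

Lemma criterion_homeomorphism K K' (f : K' -> K) :
  ext_morphism f -> homeomorphism f -> Omega_criterion K' -> Omega_criterion K.
Proof.
move=> [fc fE] [_ [g [gc fK gK]]] [[cT [hI hO] dT] clH sepH dH].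
have gE x : g (ext_map K x) = ext_map K' x by rewrite -fE fK.
have of_ (U : set K) : open U -> open (f @^-1` U) by move/continuousP: fc; apply.
have og (U : set K') : open U -> open (g @^-1` U) by move/continuousP: gc; apply.
have HE p : no_edges K p <-> no_edges K' (g p).
  split=> np [x Ex xp]; apply: np; exists x => //; last by rewrite -xp gE.
  by rewrite -fE xp gK.
have HEE : no_edges K = g @^-1` no_edges K' by apply/seteqP; split=> p /HE.
split.
- split.
  + rewrite compact_ultra => F FF _ /=.
    have UU := ultraP (ultra_map g (Ultra FF)).
    move: cT; rewrite compact_ultra => /(_ _ UU) cT.
    have [|p [_ Fp]] := cT; first exact: (@filterT _ F _).
    exists (f p); split => // A /fc/Fp; rewrite /= /fmap /=.
    by apply: (@filterS _ F) => x /=; rewrite gK.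
  + split; first by move=> x y; rewrite -!fE => /(can_inj fK)/hI.
    move=> O; split=> [/hO[U oU ->]|[U oU ->]].
      by exists (g @^-1` U); [exact: og|apply/seteqP; split=> x /=; rewrite gE].
    by apply/hO; exists (f @^-1` U); [exact: of_|apply/seteqP; split=> x /=; rewrite fE].
  + move=> O [p Op] oO.
    have [|y [Oy [x _ xy]]] := dT (f @^-1` O) _ (of_ _ oO).
      by exists (g p); rewrite /= gK.
    by exists (ext_map K x); split; [move: Oy; rewrite -xy /= fE|exists x].
- by rewrite HEE; move/continuous_closedP: gc; apply.
- move=> p q /HE Hp /HE Hq pq.
  have [|U [V [oU oV Up Vq UV]]] := sepH _ _ Hp Hq; first by move/(can_inj gK).
  exists (g @^-1` U), (g @^-1` V); split; rewrite //; try exact: og.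
  by move=> x /UV nx /HE.
- move=> O oO [p [Op Hp]].
  have [|x nEx Ox] := dH _ (of_ _ oO).
    by exists (g p); split; [rewrite /= gK|apply/HE].
  by exists x => //; rewrite -fE.
Qed.

Lemma no_edges_induced (a : comp_system G) :
  no_edges (induced R a) = ~` @inner_edges R G _ (@sys_basis G a).
Proof.
congr (~` _); apply/seteqP; split=> [_ [_ [e [t ->]] <-]|_ [e [t ->]]].
  by exists e, t.
by exists (Pt (Inner e t)) => //; exists e, t.
Qed.

Lemma induced_criterion (a : comp_system G) :
  is_Csystem a -> Omega_criterion (induced R a).
Proof.
move=> aC; rewrite /Omega_criterion no_edges_induced.
have dens (O : set (induced R a)) : open O -> O `&` ~` @inner_edges R G _ (@sys_basis G a) !=set0 ->
    exists2 x, ~ E x & O (ext_map (induced R a) x).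
  move=> oO [[[v|e t]|l] [Op np]].
  - by exists (Pt (Vertex v)) => // -[e [t]].
  - by case: np; exists e, t.
  - by have [v Ov] := lim_nbhd_vertex aC oO Op; exists (Pt (Vertex v)) => // -[e [t]].
split => //.
- split; [exact: induced_compact|exact: induced_embedding|].
  move=> O [[p|l] Op] oO; first by exists (Pt p); split => //; exists (Pt p).
  have [|x _ Ox] := dens O oO; last by exists (ext_map (induced R a) x); split => //; exists x.
  by exists (Lim l); split => // -[e [t]].
- by apply: open_closedC; exact: inner_edges_open.
- by rewrite setCK => p q; exact: induced_sep.
Qed.

Lemma top_equiv_refl K : top_equiv K K.
Proof.
exists id; split; first by split => // x.
by split; [move=> x|exists id; split => // x].
Qed.

Lemma induced_Ccompactification (a : comp_system G) :
  is_Csystem a -> is_Ccompactification (induced R a).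
Proof.
move=> aC; split; first by apply: criterion_Omega; exact: induced_criterion.
by exists a => //; exact: top_equiv_refl.
Qed.

End OmegaCriterion.

(** * Quotient maps *)

Section QuotientMaps.

Definition quotient_map (T U : topologicalType) (f : T -> U) :=
  [/\ continuous f, forall u, exists t, f t = u &
    forall O : set U, open (f @^-1` O) -> open O].

Lemma quotient_map_comp (S T U : topologicalType) (f : S -> T) (g : T -> U) :
  quotient_map f -> quotient_map g -> quotient_map (g \o f).
Proof.
move=> [fc fs fo] [gc gs go]; split.
- by move=> x; apply: continuous_comp; [exact: fc|exact: gc].
- by move=> u; have [t <-] := gs u; have [s <-] := fs t; exists s.
- by move=> O oO; apply: go; exact: fo.
Qed.

Lemma homeomorphism_quotient_map (T U : topologicalType) (f : T -> U) :
  homeomorphism f -> quotient_map f.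
Proof.
move=> [fc [g [/continuousP gc fK gK]]]; split=> // [u|O oO]; first by exists (g u).
suff <- : g @^-1` (f @^-1` O) = O by exact: gc.
by apply/seteqP; split=> x /=; rewrite gK.
Qed.

Variable Y : topologicalType.
Implicit Types K : extension Y.

Lemma ext_morphism_comp K K' K'' (f : K -> K') (g : K' -> K'') :
  ext_morphism f -> ext_morphism g -> ext_morphism (g \o f).
Proof.
move=> [fc fE] [gc gE]; split=> [x|y]; last by rewrite /= fE gE.
by apply: continuous_comp; [exact: fc|exact: gc].
Qed.

Lemma top_equiv_inv K K' (f : K' -> K) : ext_morphism f -> homeomorphism f ->
  exists2 g : K -> K', ext_morphism g & homeomorphism g.
Proof.
move=> [fc fE] [_ [g [gc fK gK]]]; exists g; first by split=> // y; rewrite -fE fK.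
by split=> //; exists f.
Qed.

(** The inverse of the factored map is the projection after a section [s] of [f]. Composed with [f]
    it is the projection itself, so it is continuous because [f] is a quotient map. *)
Lemma quotient_top_equiv K K' (f : K' -> K) (e : equiv_rel K') :
  ext_morphism f -> quotient_map f -> (forall x y, e x y = (f x == f y)) ->
  top_equiv K (quot_ext e).
Proof.
move=> [_ fE] [fc fs fo] ef.
have frepr x : f (repr (\pi_({eq_quot e})%qT x)) = f x.
  by apply/eqP; rewrite -ef; apply/eqmodP; rewrite reprK.
pose s k := sval (cid (fs k)).
have sK k : f (s k) = k by rewrite /s; case: cid.
pose g : quot_ext e -> K := f \o repr.
have gc : continuous g.
  apply/quotient_continuous; rewrite (_ : _ \o _ = f) //.
  by apply/funext => x; exact: frepr.
exists g; split; first by split => // y; rewrite /g /= frepr fE.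
split=> //; exists (fun k => (\pi_({eq_quot e})%qT (s k) : quot_ext e)); split.
- apply/continuousP => U oU; apply: fo.
  rewrite (_ : _ @^-1` _ = \pi_({eq_quot e})%qT @^-1` U) //.
  apply/seteqP; split=> x /=; rewrite (_ : \pi_({eq_quot e})%qT (s (f x)) =
    \pi_({eq_quot e})%qT x) //;
    by apply/eqmodP; rewrite /= ef sK.
- by move=> q; rewrite -[RHS]reprK; apply/eqmodP; rewrite /= ef sK.
- by move=> k; rewrite /g /= frepr sK.
Qed.

Lemma quotient_map_is_quotient K K' (f : K' -> K) :
  ext_morphism f -> quotient_map f -> is_quotient K K'.
Proof. by move=> fm fq; exists f; split=> //; exact: quotient_top_equiv fm fq _. Qed.

End QuotientMaps.

(** * Maps induced by morphisms of systems *)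

Section LimitMaps.
Context (R : realType) {G : graph} (a d : comp_system G).
Hypotheses (aC : is_Csystem a) (dC : is_Csystem d).
Variable f : forall X, d X -> a X.
Hypotheses (fm : forall X, ext_morphism (@f X))
  (fb : forall X' X (h : (X `<=` X')%fset) x, f (bond h x) = bond h (f x)).

Lemma invlim_map_subproof (l : invlim d) X' X (h : (X `<=` X')%fset) :
  bond h (f (l X')) = f (l X).
Proof. by rewrite -fb lim_coordP. Qed.

Definition invlim_map (l : invlim d) : invlim a := InvLim (@invlim_map_subproof l).

Definition induced_map : induced R d -> induced R a :=
  @add_limits_map R G _ _ _ (sys_basis (a := a)) invlim_map.

Lemma induced_map_preimage X (A : set (a X)) :
  induced_map @^-1` (lim_nbhd (R := R) A) = lim_nbhd (@f X @^-1` A).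
Proof.
apply/seteqP; split=> [[p|l]|[p|l]] //= [C AC Cp]; exists C => //.
  by rewrite /= (fm X).2.
by move: AC; rewrite /= (fm X).2.
Qed.

Lemma induced_map_morphism : ext_morphism induced_map.
Proof.
split; last first.
  move=> [p|w] //=; congr Lim; apply: invlim_ext => X /=.
  exact: (fm X).2.
apply: (subbase_continuous (@add_limits_subbase R G _ _)).
move=> _ [[U oU ->]|[X [CC [S [A oA [-> ->]] ->]]]].
  rewrite (_ : _ @^-1` _ = Pt @` U); first exact: Pt_image_open.
  by apply/seteqP; split=> [[p [q Uq [<-]]|l [q _ //]]|_ [p Up <-]]; [exists q|exists p].
rewrite -lim_nbhdE induced_map_preimage; apply: lim_nbhd_open.
by move/continuousP: (fm X).1; apply.
Qed.

Let Hd := ~` @inner_edges R G _ (@sys_basis G d).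

(** The image is compact and lies in the closed set of vertices and limit points, where separation
    up to inner edge points suffices for compact sets to be closed. *)
Lemma induced_map_closed (A : set (induced R d)) : A `<=` Hd -> closed A ->
  closed (induced_map @` A).
Proof.
move=> AH cA; have [[cT _ _] clH sepH _] := induced_criterion R aC.
rewrite !no_edges_induced in clH sepH.
apply: (compact_closed_in sepH clH) => [_ [[p|l] Ap <-]|].
- by move=> [e [t [pe]]]; apply: (AH _ Ap); exists e, t; rewrite pe.
- by move=> [e [t]].
apply: compact_image; first exact: induced_map_morphism.1.
exact: (subclosed_compact cA (induced_compact (R := R) dC)).
Qed.

(** The image of the vertices and limit points is closed, and every neighbourhood of a limit point
    contains a vertex, which is its own image. *)
Lemma induced_map_surj (x : induced R a) : exists y, induced_map y = x.
Proof.
case: x => [p|l]; first by exists (Pt p).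
have : closed (induced_map @` Hd).
  by apply: induced_map_closed => //; apply: open_closedC; exact: inner_edges_open.
suff /[swap]/[apply] : closure (induced_map @` Hd) (Lim l) by case=> y _ yl; exists y.
move=> A; rewrite nbhsE => -[O [oO Ol] OA].
have [v Ov] := lim_nbhd_vertex aC oO Ol.
exists (Pt (Vertex v)); split; last exact: OA.
by exists (Pt (Vertex v)) => // -[e [t]].
Qed.

(** On [G] the map is the identity, so openness there is inherited. At a limit point, openness of
    [O] is reduced to closedness of the image of a set [A] of vertices and limit points. *)
Lemma induced_map_quotient : quotient_map induced_map.
Proof.
have [mc _] := induced_map_morphism.
split=> //; first exact: induced_map_surj.
move=> O oO; rewrite openE => -[p|l] Ox.
  have oG : open (Pt @^-1` (induced_map @^-1` O) : set (gpoint R G)).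
    by move/continuousP: (@Pt_continuous R G _ (sys_basis (a := d))); apply.
  rewrite /interior; apply: filterS (open_nbhs_nbhs (conj (Pt_image_open _ oG) _)).
    by move=> _ [q Oq <-].
  by exists p.
(* Besides the points that must be avoided, [A] collects the ends of the edges that
   are not contained in [O]: a basic neighbourhood of a limit point that avoids
   these vertices avoids these edges. *)
pose bad v := exists e t, v \in val e /\ ~ O (Pt (Inner e t)).
pose A : set (induced R d) := [set y | Hd y /\ ~ O (induced_map y)] `|`
  [set Pt (Vertex v) | v in bad].
have AH : A `<=` Hd by move=> _ [[]//|[v _ <-]] [e [t]].
have cA : closed A.
  rewrite -openC openE => y nAy; rewrite /interior.
  case: y nAy => [[v|e t]|k] nAy.
  - apply: filterS (@vertex_nbhs R G _ (sys_basis (a := d)) v) => _ [[u|e t] /= uv <-].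
      by rewrite uv.
    by move/AH; apply; exists e, t.
  - apply: filterS (open_nbhs_nbhs (conj (@inner_edges_open R G _ (sys_basis (a := d))) _));
      last by exists e, t.
    by move=> _ [e' [t' ->]] /AH; apply; exists e', t'.
  (* A basic neighbourhood of [Lim k] inside the preimage of [O] contains every edge at each of its
     vertices, so none of its vertices is bad. *)
  - have Ok : O (induced_map (Lim k)).
      by apply: contrapT => nO; apply: nAy; left; split => // -[e [t]].
    have [X [W [oW Wk WO]]] := lim_nbhd_base dC oO Ok.
    have nW : nbhs (Lim k : induced R d) (lim_nbhd W).
      by apply: open_nbhs_nbhs; split => //; exact: lim_nbhd_open.
    apply: filterS nW.
    move=> z Wz [[_ nOz]|[v [e [t [ve nO]]] vz]]; first by apply: nOz; exact: WO.
    apply: nO; have := @WO (Pt (Inner e t)); apply; move: Wz; rewrite -vz /=.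
    by move=> [C WC Cv]; exists C => //; exists v.
have /closed_openC oN := induced_map_closed AH cA.
have Nl : (~` (induced_map @` A)) (Lim l).
  move=> [y [[_ nO] E|[v _ <-] //]].
  by apply: nO; rewrite E.
have [X [W [oW Wl WN]]] := lim_nbhd_base aC oN Nl.
have nW : nbhs (Lim l : induced R a) (lim_nbhd W).
  by apply: open_nbhs_nbhs; split => //; exact: lim_nbhd_open.
apply: filterS nW.
move=> [[v|e t]|k] Wz.
- apply: contrapT => nO; apply: (WN _ Wz); exists (Pt (Vertex v)) => //.
  by left; split => // -[e [t]].
(* The end [v] of the edge inside [C] is bad, hence in the image of [A], yet it lies in the
   neighbourhood that avoids this image. *)
- apply: contrapT => nO; have [C WC [v ve Cv]] := Wz.
  apply: (WN (Pt (Vertex v))); first by exists C.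
  by exists (Pt (Vertex v)) => //; right; exists v => //; exists e, t.
- apply: contrapT => nO; have [y yk] := induced_map_surj (Lim k).
  apply: (WN _ Wz); exists y => //; left; split; last by rewrite yk.
  by move=> [e [t yE]]; rewrite yE in yk.
Qed.

End LimitMaps.

(** * Tangles *)

Section Tangles.
Context {G : graph}.
Implicit Types (X : {fset G}) (A B C D : set G) (t : tangle G).

(** Otherwise the single separation would be a finite star of finite interior. *)
Lemma tangle_infinite t A B : tangle_set t (A, B) -> ~ finite_set B.
Proof.
move=> tAB fB; have [tS _ _ tstar] := tangleP t.
apply: (tstar [set (A, B)]).
- by move=> _ ->.
- by split=> [_ ->|A' B' C' D' -> -> //]; exact: tS.
- exact: finite_set1.
- by apply: sub_finite_set fB => x /(_ (A, B)); apply.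
Qed.

Lemma tangle_le t A B C D : tangle_set t (C, D) -> finite_sep (A, B) ->
  sep_le (A, B) (C, D) -> tangle_set t (A, B).
Proof.
move=> tCD sAB AC; have [tS tor tcons _] := tangleP t.
have [[//|tBA] _] := tor _ _ sAB; exfalso.
(* Consistency is silent when the two separations coincide. In that case [A] lies inside [B], so it
   is the finite separator, against [tangle_infinite]. *)
have [E|nE] := pselect ((B, A) = (C, D)); last first.
  apply: (tcons A B C D) => //; split => // E.
  by have [_] := tor _ _ sAB; apply; split => //; rewrite E.
case: E AC => <- <- [/= AB _]; apply: (tangle_infinite tBA).
by have [_ /= + _] := sAB; rewrite (setIidl AB).
Qed.

(** If [(D, C)] were in [t] instead, it would form with [(A, B)] a star whose interior is inside the
    finite set of common vertices of [B] and [C]. *)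
Lemma tangle_ge t A B C D : tangle_set t (A, B) -> finite_sep (C, D) ->
  sep_le (A, B) (C, D) -> finite_set (B `&` C) -> tangle_set t (C, D).
Proof.
move=> tAB sCD [/= AC DB] fBC; have [tS tor _ tstar] := tangleP t.
have [[//|tDC] _] := tor _ _ sCD; exfalso.
apply: (tstar [set (A, B); (D, C)]).
- by move=> _ [] ->.
- split=> [_ [] -> |A' B' C' D']; [exact: tS|exact: tS|].
  by move=> [] [-> ->] [] [-> ->].
- by rewrite finite_setU; split; exact: finite_set1.
- apply: sub_finite_set fBC => x ix; split; first by apply: (ix (A, B)); left.
  by apply: (ix (D, C)); right.
Qed.

Lemma finite_sep_corner A B C D : finite_sep (A, B) -> finite_sep (C, D) ->
  finite_sep (A `&` C, B `|` D).
Proof.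
move=> [/= U1 I1 N1] [/= U2 I2 N2]; split => /=.
- rewrite -subTset => x _; have : (A `|` B) x by rewrite U1.
  have : (C `|` D) x by rewrite U2.
  by move=> [Cx|Dx] [Ax|Bx]; [left|right; left|right; right|right; left].
- apply: (@sub_finite_set _ _ ((A `&` B) `|` (C `&` D))); last by rewrite finite_setU.
  by move=> x [[Ax Cx] [Bx|Dx]]; [left|right].
- move=> u v [[Au Cu] nBDu] [BDv nACv].
  have nBu : ~ B u by move=> ?; apply: nBDu; left.
  have nDu : ~ D u by move=> ?; apply: nBDu; right.
  have [Av|nAv] := pselect (A v).
    have nCv : ~ C v by move=> ?; apply: nACv.
    apply: N2 => //; split => //; have : (C `|` D) v by rewrite U2.
    by case.
  apply: N1 => //; split => //; have : (A `|` B) v by rewrite U1.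
  by case.
Qed.

(* The corner [(A `&` C, B `|` D)] lies below [(A, B)] and so belongs to [t]; with
   [(D, C)] it would form a star of finite interior. *)
Lemma tangle_almost t A B C D : tangle_set t (A, B) -> finite_sep (C, D) ->
  finite_set (B `&` C) -> tangle_set t (C, D).
Proof.
move=> tAB sCD fBC; have [tS _ _ _] := tangleP t.
have sAB := tS _ tAB.
have tcorner : tangle_set t (A `&` C, B `|` D).
  apply: tangle_le tAB _ _; first exact: finite_sep_corner.
  by split => x; [case|left].
apply: (tangle_ge tcorner sCD); first by split => x; [case|right].
apply: (@sub_finite_set _ _ ((B `&` C) `|` (C `&` D))).
  by move=> x [[Bx|Dx] Cx]; [left|right].
by rewrite finite_setU; split => //; case: sCD.
Qed.

Definition comp_sep X (CC : set (component X)) : set G * set G :=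
  (~` comps_verts CC, [set` X] `|` comps_verts CC).

Lemma comps_vertsC X (CC : set (component X)) x : x \notin X ->
  ~ comps_verts CC x <-> comps_verts (~` CC) x.
Proof.
move=> xX; have [C Cx] := comp_ex xX; split=> [nCC|[D nDD Dx] [E EE Ex]].
  by exists C => // CCC; apply: nCC; exists C.
by apply: nDD; rewrite (comp_eq Dx Ex).
Qed.

Lemma comps_verts_notin X (CC : set (component X)) x : comps_verts CC x -> x \notin X.
Proof. by move=> [C _]; exact: comp_notin. Qed.

Lemma comp_sepC X (CC : set (component X)) :
  comp_sep (~` CC) = ((comp_sep CC).2, (comp_sep CC).1).
Proof.
congr pair; apply/seteqP; split=> x /=.
- move=> nx; have [xX|xX] := boolP (x \in X); [by left|right].
  by apply: contrapT => /(comps_vertsC _ xX).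
- move=> [xX /comps_verts_notin|CCx]; first by rewrite xX.
  by have xX := comps_verts_notin CCx; move/(comps_vertsC _ xX).
- by case=> [xX /comps_verts_notin|nx CCx]; [rewrite xX|have xX := comps_verts_notin nx;
    move: nx => /(comps_vertsC _ xX)].
- move=> nx; have [xX|xX] := boolP (x \in X); [by left|right].
  by apply/(comps_vertsC _ xX).
Qed.

Lemma comp_sepI X (CC : set (component X)) :
  (comp_sep CC).1 `&` (comp_sep CC).2 = [set` X].
Proof.
apply/seteqP; split=> x /= => [[nx [//|]] //|xX].
by split; [move=> /comps_verts_notin; rewrite xX|left].
Qed.

Lemma comp_sep_finite_sep X (CC : set (component X)) : finite_sep (comp_sep CC).
Proof.
split.
- rewrite -subTset => x _.
  by have [CCx|nx] := pselect (comps_verts CC x); [right; right|left].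
- by rewrite comp_sepI; exact: finite_fset.
- move=> u v [/= nu nXu] [[vX|[C CCC Cv]] /= nv]; apply/negP => uv.
    by apply: nv => /comps_verts_notin; rewrite vX.
  apply: nu; exists C => //; rewrite (comp_reach Cv) /=.
  apply: reach1 (comp_notin Cv) _; first by rewrite adj_sym.
  by apply/negP => uX; apply: nXu; left.
Qed.

Lemma tangle_ultra_subset t X (P Q : set (component X)) :
  P `<=` Q -> tangle_ultra t P -> tangle_ultra t Q.
Proof.
move=> PQ tP; apply: (tangle_almost tP); first exact: comp_sep_finite_sep.
apply: sub_finite_set (finite_fset X) => x [[//|[C PC Cx]] []].
by exists C => //; exact: PQ.
Qed.

Lemma tangle_ultraC t X (P : set (component X)) :
  tangle_ultra t P \/ tangle_ultra t (~` P).
Proof.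
have [_ tor _ _] := tangleP t.
have [tP _] := tor _ _ (comp_sep_finite_sep P).
case: tP; [by left|right].
rewrite /tangle_ultra /=.
by have := comp_sepC P; rewrite {1}/comp_sep => ->.
Qed.

Lemma tangle_ultra0 t X : ~ tangle_ultra t (@set0 (component X)).
Proof.
move=> /tangle_infinite; apply; apply: sub_finite_set (finite_fset X).
by move=> x [//|[C]].
Qed.

(** Replacing [Q] by the union of [Q] with the complement of [P] makes any two distinct members of
    the triple [S] cover all components, so their separations form a star. The three sets have no
    common component, so the interior of the star lies in [X]. *)
Lemma tangle_ultraI t X (P Q : set (component X)) :
  tangle_ultra t P -> tangle_ultra t Q -> tangle_ultra t (P `&` Q).
Proof.
move=> tP tQ; have [//|tE] := tangle_ultraC t (P `&` Q); exfalso.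
have [tS _ _ tstar] := tangleP t.
have tQ' : tangle_ultra t (~` P `|` Q) by apply: tangle_ultra_subset tQ => x; right.
pose S := [set P; ~` P `|` Q; ~` (P `&` Q)].
have SU (M N : set (component X)) : S M -> S N -> M <> N ->
    forall K : component X, M K \/ N K.
  move=> SM SN MN K; move: SM SN MN; rewrite /S /setU /setC /setI /=.
  have [PK|nPK] := pselect (P K); have [QK|nQK] := pselect (Q K);
    by move=> [[->|->]|->] [[->|->]|->] MN; first [by case: MN | rewrite /=; tauto].
apply: (tstar [set comp_sep M | M in S]).
- by move=> _ [M [[->|->]|->] <-].
- split=> [_ [M _ <-]|A B C D [M SM [<- <-]] [N SN [<- <-]] MN].
    exact: comp_sep_finite_sep.
  have {}MN : M <> N by move=> E; apply: MN; rewrite E.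
  have sub (M' N' : set (component X)) : (forall K, M' K \/ N' K) ->
      ~` comps_verts M' `<=` [set` X] `|` comps_verts N'.
    move=> U x nx; have [xX|xX] := boolP (x \in X); [by left|right].
    have [K Cx] := comp_ex xX; case: (U K) => [MC|NC]; last by exists K.
    by case: nx; exists K.
  split=> /=; apply: sub; first exact: SU.
  by move=> K; case: (SU M N SM SN MN K); [right|left].
- apply: finite_image; rewrite !finite_setU.
  by split; [split|]; exact: finite_set1.
- apply: sub_finite_set (finite_fset X) => x ix.
  have [xX|xX] := boolP (x \in X); first by [].
  have [K Cx] := comp_ex xX.
  have inS M : S M -> M K.
    move=> SM; have [|[E ME Ex]] := ix (comp_sep M) (ex_intro2 _ _ M SM erefl).
      by move=> /= xX'; rewrite xX' in xX.
    by rewrite (comp_eq Cx Ex).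
  have PC : P K by apply: inS; left; left.
  have [//|QC] : (~` P `|` Q) K by apply: inS; left; right.
  have nPQ : (~` (P `&` Q)) K by apply: inS; right.
  by case: nPQ.
Qed.

Lemma tangle_ultra_ultra t X : UltraFilter (@tangle_ultra G t X).
Proof.
apply: ultra_dichotomy; [|exact: tangle_ultra0|exact: tangle_ultraC].
split; last by move=> P Q; exact: tangle_ultra_subset.
  have [//|] := tangle_ultraC t (@setT (component X)).
  by rewrite setCT => /tangle_ultra0.
by move=> P Q; exact: tangle_ultraI.
Qed.

(** Passing from [P] to its preimage loses only vertices of the finite set [X'], so [tangle_almost]
    applies. *)
Lemma tangle_ultra_map t X' X (h : (X `<=` X')%fset) (P : set (component X)) :
  tangle_ultra t P -> tangle_ultra t (comp_map h @^-1` P).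
Proof.
move=> tP; apply: (tangle_almost tP); first exact: comp_sep_finite_sep.
apply: (@sub_finite_set _ _ [set` X']); last exact: finite_fset.
move=> x [xP nx]; apply: contrapT => /negP xX'.
have [C Cx] := comp_ex xX'; apply: nx; exists C => //=.
case: xP => [xX|[D PD Dx]].
  by move/negP: xX' => []; exact: (fsubsetP h).
by rewrite (comp_map_eq h Cx Dx).
Qed.

Lemma tangle_lim_subproof t X' X (h : (X `<=` X')%fset) :
  bond h (Ultra (tangle_ultra_ultra t X') : ultra_system X') =
  (Ultra (tangle_ultra_ultra t X) : ultra_system X).
Proof.
apply: ultra_inj; have UU := tangle_ultra_ultra t X.
apply: (@max_filter _ (@tangle_ultra G t X) _).
  exact: (@ultra_proper _ _ (ultraP (ultra_map (comp_map h) (Ultra (tangle_ultra_ultra t X'))))).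
by move=> P tP; exact: tangle_ultra_map.
Qed.

Definition tangle_lim t : invlim (ultra_system (G := G)) :=
  InvLim (@tangle_lim_subproof t).

Lemma comp_side X A B (C : component X) : finite_sep (A, B) ->
  (fset_set (A `&` B) `<=` X)%fset -> C `<=` B `\` A \/ C `<=` A `\` B.
Proof.
move=> sAB AX; have [x Cx] := comp_nonempty C.
have [U fI _] := sAB.
have nI : ~ (A `&` B) x.
  by move=> xI; have := comp_notin Cx; rewrite (fsubsetP AX) // in_fset_set ?inE.
have : (A `|` B) x by rewrite -[A `|` B]/((A, B).1 `|` (A, B).2) U.
case=> [Ax|Bx]; [right|left] => y; rewrite (comp_reach Cx) /= => xy.
  apply: (finite_sep_reach (finite_sepC sAB) (u := x)).
    by rewrite setIC; exact: reach_sub xy.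
  by split => // Bx; apply: nI.
apply: (finite_sep_reach sAB (u := x)); first exact: reach_sub xy.
by split => // Ax; apply: nI.
Qed.

(** Every separation of finite order thus comes from a set of components, which is why the
    ultrafilters of a tangle determine it. *)
Lemma sep_comp_sep A B : finite_sep (A, B) ->
  (A, B) = comp_sep [set C : component (fset_set (A `&` B)) | C `<=` B `\` A].
Proof.
move=> sAB; have [/= U fI _] := sAB.
have VE : comps_verts [set C : component (fset_set (A `&` B)) | C `<=` B `\` A] = B `\` A.
  apply/seteqP; split=> x; first by move=> [C CB /CB].
  move=> [Bx nAx]; have xI : x \notin fset_set (A `&` B).
    by rewrite in_fset_set //; apply/negP; rewrite inE => -[].
  have [C Cx] := comp_ex xI; exists C => //=.
  by have [//|CA] := comp_side C sAB (fsubset_refl _); case: (CA _ Cx).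
have UX x : A x \/ B x by have : (A `|` B) x by rewrite U.
rewrite /comp_sep VE fset_setK //; congr pair; apply/seteqP; split=> x /=.
- by move=> Ax [].
- by move=> nBA; apply: contrapT => nAx; case: (UX x) => // Bx; apply: nBA.
- by move=> Bx; have [Ax|nAx] := pselect (A x); [left|right].
- by case=> [[]|[]].
Qed.

Lemma tangle_lim_inj : injective tangle_lim.
Proof.
move=> t t' E.
have tu X (P : set (component X)) : tangle_ultra t P <-> tangle_ultra t' P.
  have := congr1 (fun u : invlim (ultra_system (G := G)) => ultra_filter (u X) P) E.
  by rewrite /= => ->.
have tt' : tangle_set t = tangle_set t'.
  have [tS _ _ _] := tangleP t; have [tS' _ _ _] := tangleP t'.
  apply/seteqP; split=> [[A B] tAB|[A B] tAB].
    by have sAB := tS _ tAB; move: tAB; rewrite (sep_comp_sep sAB) => /tu.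
  by have sAB := tS' _ tAB; move: tAB; rewrite (sep_comp_sep sAB) => /tu.
case: (t) (t') tt' => [s p] [s' p'] /= ss'; move: p; rewrite ss' => p.
by rewrite (Prop_irrelevance p p').
Qed.

Section UltraTangle.
Variable u : invlim (ultra_system (G := G)).

Definition big_side X (S : set G * set G) : set (component X) :=
  [set C | C `<=` S.2 `\` S.1].
Arguments big_side : clear implicits.

Definition ultra_tangle_set : set (set G * set G) :=
  [set S | finite_sep S /\
     ultra_filter (u (fset_set (S.1 `&` S.2))) (big_side (fset_set (S.1 `&` S.2)) S)].

(** Enlarging the separator does not change the verdict of the ultrafilters, so finitely many
    separations can be compared over one finite set. *)
Lemma big_side_up X X' (h : (X `<=` X')%fset) S : finite_sep S ->
  (fset_set (S.1 `&` S.2) `<=` X)%fset ->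
  ultra_filter (u X) (big_side X S) <-> ultra_filter (u X') (big_side X' S).
Proof.
case: S => A B sAB SX; rewrite -(lim_coordP u h) /= /fmap /=.
suff -> : comp_map h @^-1` big_side X (A, B) = big_side X' (A, B) by [].
apply/seteqP; split=> C /= CB.
  by apply: subset_trans CB; exact: comp_map_sub.
have [//|CA] := comp_side (comp_map h C) sAB SX.
have [x Cx] := comp_nonempty C.
have [_ nBx] := CA _ (comp_map_sub h Cx).
by have [/nBx] := CB _ Cx.
Qed.

Lemma ultra_tangle_setE X S : finite_sep S -> (fset_set (S.1 `&` S.2) `<=` X)%fset ->
  ultra_tangle_set S <-> ultra_filter (u X) (big_side X S).
Proof.
move=> sS h; split=> [[_ ]|uS].
  by move/(big_side_up h sS (fsubset_refl _)).
by split => //; apply/(big_side_up h sS (fsubset_refl _)).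
Qed.

Lemma ultra_tangle_subproof : is_tangle ultra_tangle_set.
Proof.
have uu X := ultraP (u X).
split.
- by move=> S [].
- move=> A B sAB; set X := fset_set (A `&` B).
  have sBA := finite_sepC sAB.
  have EA := ultra_tangle_setE sAB (fsubset_refl _).
  have := @ultra_tangle_setE X _ sBA; rewrite /= setIC => /(_ (fsubset_refl _)) EB.
  rewrite EA EB /= -/X.
  have cover : big_side X (A, B) `|` big_side X (B, A) = setT.
    rewrite -subTset => C _; have [|] := comp_side C sAB (fsubset_refl _); by [left|right].
  have disj : big_side X (A, B) `&` big_side X (B, A) = set0.
    rewrite -subset0 => C [/= C1 C2]; have [x Cx] := comp_nonempty C.
    by have [_ nAx] := C1 _ Cx; have [/nAx] := C2 _ Cx.
  split; last first.
    move=> [U1 U2]; have : ultra_filter (u X) (big_side X (A, B) `&` big_side X (B, A)).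
      exact: filterI.
    by rewrite disj => /filter_not_empty.
  have [?|nU] := in_ultra_setVsetC (big_side X (A, B)) (uu X); [by left|right].
  apply: filterS nU => C nC.
  have : (big_side X (A, B) `|` big_side X (B, A)) C by rewrite cover.
  by case.
- move=> A B C D uBA uCD _ [[/= AC DB] _].
  have sBA := uBA.1; have sCD := uCD.1.
  pose X := (fset_set (B `&` A) `|` fset_set (C `&` D))%fset.
  move/(ultra_tangle_setE sBA (fsubsetUl _ _ : (_ `<=` X)%fset)): uBA => uBA.
  move/(ultra_tangle_setE sCD (fsubsetUr _ _ : (_ `<=` X)%fset)): uCD => uCD.
  have [E [E1 E2]] := filter_ex (filterI uBA uCD).
  have [x Ex] := comp_nonempty E.
  by have [Ax _] := E1 _ Ex; have [_ nCx] := E2 _ Ex; exact/nCx/AC.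
- move=> sg sgu _ /finite_seqP[q sgE] fI.
  pose X0 := fset_set (star_interior sg).
  (* [X] contains all separators and the supposedly finite interior. Some component of [G - X] lies
     on the big side of every member of the star, hence in the interior, although it avoids [X]. *)
  pose X := (X0 `|` \bigcup_(S <- q) fset_set (S.1 `&` S.2))%fset.
  have : ultra_filter (u X) (\bigcap_(S in [set` [fset S in q]%fset]) big_side X S).
    apply: filter_bigI => S; rewrite !inE => Sq.
    have uS : ultra_tangle_set S by apply: sgu; rewrite sgE.
    apply/(ultra_tangle_setE uS.1 _) => //.
    apply: fsubset_trans (fsubsetUr _ _).
    by apply: (@bigfcup_sup _ _ q S xpredT (fun S => fset_set (S.1 `&` S.2))).
  move=> /filter_ex[C Cq]; have [x Cx] := comp_nonempty C.
  have /negP := comp_notin Cx; apply; rewrite inE; apply/orP; left.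
  rewrite in_fset_set // inE => S; rewrite sgE /= => Sq.
  by have [] := Cq S _ _ Cx => //=; rewrite inE.
Qed.

Definition ultra_tangle : tangle G := Tangle ultra_tangle_subproof.

Lemma ultra_tangleK : tangle_lim ultra_tangle = u.
Proof.
apply: invlim_ext => X; apply: ultra_inj; apply/funext => P; apply/propext => /=.
have sP := comp_sep_finite_sep P.
have XE : fset_set ((comp_sep P).1 `&` (comp_sep P).2) = X by rewrite comp_sepI set_fsetK.
have := @ultra_tangle_setE X _ sP; rewrite XE => /(_ (fsubset_refl _)) E.
suff PE : big_side X (comp_sep P) = P by rewrite PE in E.
apply/seteqP; split=> C; last first.
  move=> PC x Cx; split; first by right; exists C.
  by move=> /=; apply; exists C.
have [x Cx] := comp_nonempty C.
by move=> /(_ _ Cx)[_ /contrapT[D PD Dx]]; rewrite (comp_eq Cx Dx).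
Qed.

End UltraTangle.

Lemma tangle_lim_end w : tangle_lim (end_tangle w) = end_lim ultra_system w.
Proof.
apply: invlim_ext => X; apply: ultra_inj; apply/funext => P; apply/propext.
transitivity (P (end_comp X w)); last by split; move/(ultra_principalE _ P).
rewrite /= /tangle_ultra /= /end_tangle_set /=.
have := comp_sepI P; rewrite /= => ->; rewrite set_fsetK.
split=> [[_ Pw]|Pw].
  have [x Cx] := comp_nonempty (end_comp X w).
  by have [_ /contrapT[D PD Dx]] := Pw _ Cx; rewrite (comp_eq Cx Dx).
split; first exact: comp_sep_finite_sep.
move=> x Cx; split; first by right; exists (end_comp X w).
by apply; exists (end_comp X w).
Qed.

End Tangles.

(** * Directions and ends *)

Section Directions.
Context {G : graph}.
Implicit Types (X Q : {fset G}) (q t : seq G).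

(** Dependent choice: [P n q] admits [x0 :: q] as the path at stage [n], and the properly growing
    paths exhaust a ray. The conclusion locates the last vertex of each chosen path on the ray, at
    an index of at least [n]. *)
Lemma ray_extend (P : nat -> seq G -> Prop) (x0 : G) :
  P 0%N [::] ->
  (forall n q, P n q -> uniq (x0 :: q) /\ path adj x0 q) ->
  (forall n q, P n q -> exists2 t, t <> [::] & P n.+1 (q ++ t)) ->
  exists2 r, ray r & forall n, exists2 q, P n q /\ (n <= size q)%N & r (size q) = last x0 q.
Proof.
move=> P0 Pup Pstep.
have [next nextP] : exists next : nat -> seq G -> seq G,
    forall n q, P n q -> next n q <> [::] /\ P n.+1 (q ++ next n q).
  have /choice[f fP] : forall nq : nat * seq G, exists t,
      P nq.1 nq.2 -> t <> [::] /\ P nq.1.+1 (nq.2 ++ t).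
    move=> [n q]; have [/Pstep[t t0 Pt]|nP] := pselect (P n q); first by exists t.
    by exists [::] => /nP.
  by exists (fun n q => f (n, q)) => n q; exact: (fP (n, q)).
pose s := fix s n := if n is m.+1 then s m ++ next m (s m) else [::].
have Ps n : P n (s n) by elim: n => //= n /nextP[].
have size_s n : (n <= size (s n))%N.
  elim: n => //= n IH; rewrite size_cat; have [+ _] := nextP _ _ (Ps n).
  by case: (next n (s n)) => //= y t _; rewrite addnS ltnS (leq_trans IH) ?leq_addr.
(* The path at stage [k] has at least [k] edges, so the default [x0] of [nth] is never reached. *)
pose r k := nth x0 (x0 :: s k) k.
have rE m k : (k <= size (s m))%N -> nth x0 (x0 :: s m) k = r k.
  have up n i : (i <= size (s n))%N -> forall j, nth x0 (x0 :: s (n + j)%N) i = nth x0 (x0 :: s n) i.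
    move=> ins; elim=> [|j IH]; first by rewrite addn0.
    rewrite addnS /= -IH -cat_cons nth_cat /=.
    suff -> : (i < (size (s (n + j)%N)).+1)%N by [].
    rewrite ltnS (leq_trans ins) //; elim: (j) => [|l IHl]; first by rewrite addn0.
    by rewrite addnS /= size_cat (leq_trans IHl) ?leq_addr.
  move=> km; rewrite -(up m k km k) /r -(up k k (size_s k) m).
  by rewrite addnC.
exists r.
  split=> [i j|n].
    wlog ij : i j / (i <= j)%N => [W|].
      by have [/W//|/ltnW/W H /esym/H] := leqP i j.
    have [uj _] := Pup _ _ (Ps j).
    rewrite -(rE j i) ?(leq_trans ij) // -(rE j j) // => /eqP.
    by rewrite nth_uniq //= ?ltnS ?(leq_trans ij) // => /eqP.
  have [_ /(pathP x0) pn] := Pup _ _ (Ps n.+1).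
  by have := pn n (size_s n.+1); rewrite (rE _ _ (ltnW (size_s n.+1))) -(rE n.+1 n.+1).
by move=> n; exists (s n) => //; rewrite -(rE n) // nth_last.
Qed.

Lemma reach_uniq_path X x y : reach X x y -> exists t,
  [/\ path (avoid_adj X) x t, uniq (x :: t) & y = last x t].
Proof. by move=> [p pp ->]; case/shortenP: pp => t pt ut _; exists t. Qed.

Lemma path_reach X x t z : path (avoid_adj X) x t -> z \in t -> z \notin X /\ reach X x z.
Proof.
move=> pt zt; case/splitPr: zt pt => t1 t2; rewrite cat_path /= => /and3P[p1 pz _].
have /and3P[az nX zX] := pz; split => //; exists (rcons t1 z); last by rewrite last_rcons.
by rewrite rcons_path p1.
Qed.

Lemma avoid_path_adj X x t : path (avoid_adj X) x t -> path adj x t.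
Proof. by apply: sub_path => u v /and3P[]. Qed.

Variable c : forall X, component X.
Hypothesis cP : forall X' X (h : (X `<=` X')%fset), comp_map h (c X') = c X.

Local Notation dirc X := (vset (c X)).

Lemma direction_sub X X' : (X `<=` X')%fset -> dirc X' `<=` dirc X.
Proof. by move=> h; rewrite -(cP h); exact: comp_map_sub. Qed.

Lemma comp_adj X x y : dirc X x -> adj x y -> y \notin X -> dirc X y.
Proof.
move=> cx xy yX; rewrite (comp_reach cx); apply: reach1 => //.
exact: comp_notin cx.
Qed.

Lemma direction_ray r : ray r -> (forall X, exists n, dirc X (r n)) ->
  exists w : graph_end G, forall X, end_comp X w = c X.
Proof.
move=> rr rc.
have rt X : tail_in r (c X).
  have [C rC] := ray_tail X rr; have [N CN] := rC.
  (* Adding the first [N] vertices of the ray forces the vertex given by [rc] to lie on the tail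
     that stays in [C]. *)
  pose X' := (X `|` [fset r i | i in iota 0 N])%fset.
  have [n cn] := rc X'; have := comp_notin cn.
  rewrite !inE negb_or => /andP[nX nN].
  have Nn : (N <= n)%N.
    rewrite leqNgt; apply: contra nN => nN.
    by apply/imfsetP; exists n; rewrite //= mem_iota.
  have cXn := direction_sub (fsubsetUl _ _ : (X `<=` X')%fset) cn.
  by rewrite (comp_eq cXn (CN _ Nn)).
have rayE : exists2 r', ray r' & [set s | ray s /\ ray_equiv r s] =
    [set s | ray s /\ ray_equiv r' s] by exists r.
exists (End rayE) => X.
apply: (tail_in_eq (r := r)) => //; apply: end_comp_tail; split => // Y.
by exists (c Y).
Qed.

(** These are the vertices that dominate the end to be found. *)
Let U := [set v | forall X, v \notin X -> dirc X v].

(* A ray through infinitely many vertices of [U] meets every [c X]. *)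
Lemma direction_dominated : infinite_set U ->
  exists2 r, ray r & forall X, exists n, dirc X (r n).
Proof.
move=> infU.
have [x0 Ux0] : exists x, U x.
  apply: contrapT => nU; apply: infU.
  by apply: sub_finite_set (@finite_set0 _) => x Ux; apply: nU; exists x.
have [||n q [uq pq Uq]|r rr rP] :=
  @ray_extend (fun _ q => [/\ uniq (x0 :: q), path adj x0 q & U (last x0 q)]) x0.
- by [].
- by move=> n q [].
- have [u Uu uq'] : exists2 u, U u & u \notin x0 :: q.
    apply: contrapT => nu; apply: infU; apply: (@sub_finite_set _ _ [set` x0 :: q]) => [x Ux|].
      by apply: contrapT => /negP xq; apply: nu; exists x.
    by apply/finite_seqP; exists (x0 :: q).
  (* The last vertex is left out, as the path continues from it. It and [u] are in [U], so both lie
     in [c Q] and are joined by a path avoiding the earlier vertices. *)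
  pose Q := [fset x in belast x0 q]%fset.
  have uq2 := uq; rewrite lastI rcons_uniq in uq2; have /andP[lq ub] := uq2.
  have cl : dirc Q (last x0 q) by apply: Uq; rewrite !inE.
  have cu : dirc Q u.
    by apply: Uu; rewrite !inE; apply: contra uq'; exact: mem_belast.
  move: cu; rewrite (comp_reach cl) => /reach_uniq_path[t [pt ut ul]].
  have tQ z : z \in t -> z \notin belast x0 q by move=> /(path_reach pt)[]; rewrite !inE.
  exists t; first by move=> t0; move: uq'; rewrite ul t0 /= lastI mem_rcons inE eqxx.
  split.
  + rewrite -cat_cons lastI cat_rcons cat_uniq ub ut andbT /= negb_or lq /=.
    by apply/hasPn => z /tQ.
  + by rewrite cat_path pq; exact: avoid_path_adj pt.
  + by rewrite last_cat -ul.
- exists r => // X; have [N XN] := ray_avoid rr (finite_fset X).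
  have [q [[_ _ Uq] Nq] rq] := rP N; exists (size q); rewrite rq; apply: Uq.
  by rewrite -rq; apply/negP; exact: XN.
Qed.

(* If [U] is finite, there is a decreasing sequence of components [c (Q n)] which
   every vertex eventually leaves; a ray entering all of them meets every [c X]. *)
Lemma direction_undominated : finite_set U ->
  exists2 r, ray r & forall X, exists n, dirc X (r n).
Proof.
move=> finU.
have /choice[g gP] : forall v, exists X, ~ U v -> v \notin X /\ ~ dirc X v.
  move=> v; have [Uv|/existsNP[X /not_implyP[vX ncv]]] := pselect (U v); first by exists fset0.
  by exists X.
(* For each vertex of [Q] outside [U] a finite set witnessing that it is excluded is added, so that
   the new component has no neighbour in [Q] outside [U]. *)
pose step Q := (Q `|` fset_set U `|` \bigcup_(v <- Q) g v)%fset.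
have stepP Q x y : ~ U y -> dirc (step Q) x -> adj x y -> y \notin Q.
  move=> nUy cx xy; apply/negP => yQ; have [ygy ncy] := gP _ nUy.
  apply: ncy; apply: comp_adj xy ygy; apply: direction_sub cx.
  apply: fsubset_trans (fsubsetUr _ _).
  by apply: (@bigfcup_sup _ _ _ y xpredT g).
have [v0 cv0] := comp_nonempty (c (fset_set U)).
pose Q n := iter n step (v0 |` fset_set U)%fset.
have QS n : (Q n `<=` Q n.+1)%fset by rewrite /= /step -fsetUA fsubsetUl.
have Qle m n : (m <= n)%N -> (Q m `<=` Q n)%fset.
  by move=> /subnK <-; elim: (n - m)%N => [//|k IH]; exact: fsubset_trans IH (QS _).
have UQ n : (fset_set U `<=` Q n)%fset.
  by apply: fsubset_trans (Qle 0%N n _) => //; rewrite /Q /= fsubsetUr.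
have Dle m n : (m <= n)%N -> c (Q n) `<=` dirc (Q m) by move=> /Qle; exact: direction_sub.
(* If [v] never left, neither would its neighbours outside [U], and by induction along a walk
   neither would [v0]; but [v0] was put into [Q 0]. *)
have leave v : exists n, ~ dirc (Q n) v.
  apply: contrapT => nv; have Dv n : dirc (Q n) v by apply: contrapT => nc; apply: nv; exists n.
  have := direction_sub (UQ 0%N) (Dv 0%N) => cv; move: cv0; rewrite (comp_reach cv) => vv0.
  have /(_ 0%N)/comp_notin : forall n, dirc (Q n) v0.
    apply: (@reach_ind _ _ (fun z => forall n, dirc (Q n) z) _ _ vv0) => // u w Du uw _ wU n.
    apply: (comp_adj (Du n) uw); apply: (stepP _ _ _ _ (Du n.+1) uw) => Uw.
    by move: wU; rewrite in_fset_set // => /negP; apply; rewrite inE.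
  by rewrite !inE eqxx.
have leaveX X : exists n, forall x, x \in X -> ~ dirc (Q n) x.
  elim/finSet_rect: X => X IH; have [->|[x xX]] := fset_0Vmem X; first by exists 0%N.
  have [|n nP] := IH (X `\ x)%fset; first by rewrite fproperD1.
  have [m mP] := leave x; exists (maxn n m) => y yX cy.
  have [yx|yx] := eqVneq y x.
    by apply: mP; rewrite -yx; exact: Dle (leq_maxr n m) _ cy.
  by apply: (nP y); [rewrite !inE yx|exact: Dle (leq_maxl n m) _ cy].
(* A component that misses [X] is connected in [G - X], and it shares with [c X] a vertex of the
   component chosen for the union of [Q n] and [X]. *)
have Dsub X n : (forall x, x \in X -> ~ dirc (Q n) x) -> c (Q n) `<=` c X.
  move=> XD; have [x cx] := comp_nonempty (c (Q n `|` X)%fset).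
  have cQ := direction_sub (fsubsetUl _ _) cx; have cX := direction_sub (fsubsetUr _ _) cx.
  move=> y; rewrite (comp_reach cQ) => xy.
  suff [] : dirc (Q n) y /\ dirc X y by [].
  apply: (@reach_ind _ _ (fun z => dirc (Q n) z /\ dirc X z) _ _ xy) => // u w [Qu Xu] uw _ wQ.
  have Qw := comp_adj Qu uw wQ; split => //; apply: (comp_adj Xu uw).
  by apply/negP => /XD.
have [x0 cx0] := comp_nonempty (c (Q 0%N)).
have [||n q [uq pq [m [nm cm bm]]]|r rr rP] :=
  @ray_extend (fun n q => [/\ uniq (x0 :: q), path adj x0 q &
    exists m, [/\ (n <= m)%N, dirc (Q m) (last x0 q) &
      forall z, z \in belast x0 q -> ~ dirc (Q m) z]]) x0.
- by split => //; exists 0%N.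
- by move=> n q [].
- have [m' nm'] := leave (last x0 q).
  have mm' : (m < m')%N by rewrite ltnNge; apply/negP => /Dle/(_ _ cm).
  have [y cy] := comp_nonempty (c (Q m')).
  have := Dle _ _ (ltnW mm') _ cy; rewrite (comp_reach cm) => /reach_uniq_path[t [pt ut yt]].
  have tD z : z \in t -> dirc (Q m) z.
    by move=> /(path_reach pt)[_]; rewrite (comp_reach cm).
  have ht : has (fun z => `[< dirc (Q m') z >]) t.
    apply/hasP; exists y; last exact/asboolP.
    case: t yt {pt ut tD} => [/= yl|z t /= ->]; last exact: mem_last.
    by case: nm'; rewrite -yl.
  (* The path is cut at its first vertex in [c (Q m')], so that only its last vertex is in this
     component, as the invariant requires at [m']. *)
  case: (split_find ht) pt ut yt tD => z t1 t2 /asboolP cz nt1 pt ut yt tD.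
  exists (rcons t1 z); first by case: t1 {pt ut yt tD nt1}.
  have uq2 := uq; rewrite lastI rcons_uniq in uq2; have /andP[lq ub] := uq2.
  split.
  + rewrite -cat_cons cat_uniq in ut; have /andP[ut1 _] := ut.
    rewrite -cat_cons lastI cat_rcons cat_uniq ub ut1 andbT /= negb_or lq /=.
    apply/hasPn => x xt; apply/negP => /bm; apply; apply: tD.
    by rewrite mem_cat xt.
  + rewrite cat_path pq; move: pt; rewrite cat_path => /andP[pt _].
    exact: avoid_path_adj pt.
  + exists m'; split; first exact: leq_ltn_trans nm mm'.
      by rewrite last_cat last_rcons.
    move=> x; rewrite belast_cat mem_cat belast_rcons inE => /orP[xb|].
      by move=> /(Dle _ _ (ltnW mm')); exact: bm.
    move=> /orP[/eqP -> //|xt1] cx; move/hasPn: nt1 => /(_ _ xt1)/asboolP; exact.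
- exists r => // X; have [n XD] := leaveX X.
  have [q [[_ _ [m [nm cm _]]] _] rq] := rP n.
  by exists (size q); rewrite rq; apply: (Dsub X n XD); exact: Dle nm _ cm.
Qed.

Lemma direction_end : exists w : graph_end G, forall X, end_comp X w = c X.
Proof.
have [/direction_undominated|/direction_dominated] := pselect (finite_set U);
  by case=> r rr; exact: direction_ray.
Qed.

End Directions.

(** * Comparing compactifications through their systems *)

Section Comparison.
Context (R : realType) {G : graph} (a d : comp_system G).
Hypotheses (aC : is_Csystem a) (dC : is_Csystem d) (ad : Cle a d).

Lemma Cle_quotient_map (K K' : extension (ends_space R G)) :
  top_equiv K (induced R a) -> top_equiv K' (induced R d) ->
  exists2 f : K' -> K, ext_morphism f & quotient_map f.
Proof.
move=> [k [km kh]] [k' [km' kh']]; have [f [fm fb]] := ad.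
have [g gm gh] := top_equiv_inv km' kh'.
exists (k \o (induced_map (R := R) fb \o g)).
  apply: ext_morphism_comp km; apply: ext_morphism_comp gm _.
  exact: induced_map_morphism.
apply: quotient_map_comp; last exact: homeomorphism_quotient_map.
apply: quotient_map_comp; first exact: homeomorphism_quotient_map.
exact: induced_map_quotient.
Qed.

End Comparison.

(** * The tangle space and the ultrafilter system *)

Section TangleSpace.
Context (R : realType) {G : graph}.
Notation US := (ultra_system (G := G)).

Definition tangle_to_induced : tangle_space R G -> induced R US :=
  @add_limits_map R G _ _ _ (sys_basis (a := US)) tangle_lim.

(** The induced space uses all open sets of ultrafilters, the tangle space only the basic ones. An
    open set is the union of the basic sets inside it, and its preimage splits into the
    corresponding basic sets. *)
Lemma tangle_to_induced_morphism : ext_morphism tangle_to_induced.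
Proof.
split; last by move=> [p|w] //=; rewrite tangle_lim_end.
apply: (subbase_continuous (@add_limits_subbase R G _ _)).
have preim (U : set (gpoint R G)) S : tangle_to_induced @^-1` (Pt @` U `|` Lim @` S) =
    Pt @` U `|` Lim @` (tangle_lim @^-1` S).
  apply/seteqP; split; last first.
    by move=> _ [[p Up <-]|[t St <-]]; [left; exists p|right; exists (tangle_lim t)].
  move=> [p|t] [[q Uq E]|[l Sl E]] //; first by left; exists q => //; case: E => ->.
  by right; exists t => //=; move/Lim_inj: E Sl => ->.
move=> _ [[U oU ->]|[X [CC [S [O oO [-> ->]] ->]]]].
  rewrite -[Pt @` U]setU0 -(image_set0 Lim) preim preimage_set0 image_set0 setU0.
  exact: Pt_image_open.
rewrite preim.
pose F := [set P : set (component X) | [set W : ultra _ | ultra_filter W P] `<=` O].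
suff -> : Pt @` region (ext_map (US X) @^-1` O) `|`
    Lim @` (tangle_lim @^-1` [set x : invlim US | O (x X)]) =
    \bigcup_(P in F) (Pt @` region P `|`
      Lim @` [set t | tangle_ultra t P] : set (tangle_space R G)).
  by apply: bigcup_open => P _; apply: limit_basic_open.
apply/seteqP; split=> [_ [[p /region_in_comp[C OC Cp] <-]|[t Ot <-]]|
  _ [P FP [[p /region_in_comp[C PC Cp] <-]|[t tP <-]]]].
- have [P PC PO] := ultra_open_basic oO OC.
  exists P => //; left; exists p => //; apply/region_in_comp; exists C => //.
  exact/ultra_principalE.
- have [P PC PO] := ultra_open_basic oO Ot.
  by exists P => //; right; exists t.
- left; exists p => //; apply/region_in_comp; exists C => //.
  by apply: FP; apply/ultra_principalE.
- by right; exists t => //; exact: FP.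
Qed.

Lemma tangle_to_induced_homeo : homeomorphism tangle_to_induced.
Proof.
split; first exact: tangle_to_induced_morphism.1.
pose inv : induced R US -> tangle_space R G :=
  @add_limits_map R G _ _ _ (@tangle_basis G) (@ultra_tangle G).
exists inv; split.
- apply: (subbase_continuous (@add_limits_subbase R G _ _)).
  move=> _ [[U oU ->]|[X [CC [S -> ->]]]].
    rewrite (_ : _ @^-1` _ = Pt @` U); first exact: Pt_image_open.
    by apply/seteqP; split=> [[p [q Uq [<-]]|l [q _ //]]|_ [p Up <-]]; [exists q|exists p].
  rewrite (_ : _ @^-1` _ = lim_nbhd (a := US) (X := X) [set W | ultra_filter W CC]).
    by apply: lim_nbhd_open; exact: ultra_basic_open.
  have tu l : tangle_ultra (ultra_tangle l) CC <-> ultra_filter (l X) CC.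
    by have := congr1 (fun u : invlim US => ultra_filter (u X) CC) (ultra_tangleK l) => <-.
  apply/seteqP; split; last first.
    move=> [p|l] /=.
      move=> [C /ultra_principalE CCC Cp]; left; exists p => //.
      by apply/region_in_comp; exists C.
    by move=> /tu lCC; right; exists (ultra_tangle l).
  move=> [p|l] [[q Uq E]|[t St E]] //=.
    case: E Uq => -> /region_in_comp[C CCC Cp]; exists C => //.
    exact/ultra_principalE.
  by apply/tu; move: E St => [<-].
- by move=> [p|t] //; congr Lim; apply: tangle_lim_inj; exact: ultra_tangleK.
- by move=> [p|l] //; congr Lim; exact: ultra_tangleK.
Qed.

Lemma top_equiv_tangle_induced : top_equiv (tangle_space R G) (induced R US).
Proof.
have [g gm gh] := top_equiv_inv tangle_to_induced_morphism tangle_to_induced_homeo.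
by exists g.
Qed.

Lemma tangle_Ccompactification : is_Ccompactification (tangle_space R G).
Proof.
have uC := ultra_Csystem G; split; last by exists US => //; exact: top_equiv_tangle_induced.
have [g gm gh] := top_equiv_inv tangle_to_induced_morphism tangle_to_induced_homeo.
apply: criterion_Omega; apply: criterion_homeomorphism gm gh _.
exact: induced_criterion.
Qed.

End TangleSpace.

(** * Limit points with a critical coordinate *)

Section CriticalLimits.
Context {G : graph}.
Implicit Types (X Y Z : {fset G}) (l : invlim (gamma_system (G := G))).

(** Bonding maps send components, and critical sets not inside [X], to components. So a critical
    coordinate at [X] can only come from the same critical set at [Z]. *)
Lemma gamma_lim_up l X Z (Y : crit_in X) : (X `<=` Z)%fset -> l X = GCrit Y ->
  exists2 W : crit_in Z, l Z = GCrit W & crit_set W = crit_set Y.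
Proof.
move=> h lX; have := lim_coordP l h; rewrite lX /=.
case: (l Z : gamma Z) => [C //|W]; exists W => //.
have [WX|/fsubsetPn[y yW yX]] := boolP (crit_set W `<=` X)%fset.
  by move: H; rewrite (gamma_bond_crit_in h WX) => -[<-].
have [D Dy] := comp_ex yX.
by move: H; rewrite (gamma_bond_crit_out h yW Dy).
Qed.

Lemma gamma_lim_crit l X Z (Y : crit_in X) (YZ : (crit_set Y `<=` Z)%fset) :
  l X = GCrit Y -> l Z = GCrit (CritIn YZ (@crit_crit _ _ Y)).
Proof.
move=> /(gamma_lim_up (fsubsetUl X Z))[W lW WY].
rewrite -(lim_coordP l (fsubsetUr X Z)) lW.
have WZ : (crit_set W `<=` Z)%fset by rewrite WY.
transitivity (GCrit (CritIn WZ (@crit_crit _ _ W))); first exact: gamma_bond_crit_in.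
by congr GCrit; exact: crit_inj.
Qed.

Lemma gamma_lim_crit_sub l X Z (Y : crit_in X) (W : crit_in Z) :
  l X = GCrit Y -> l Z = GCrit W -> crit_set W = crit_set Y.
Proof.
move=> /(gamma_lim_up (fsubsetUl X Z))[Y1 lY1 <-] /(gamma_lim_up (fsubsetUr X Z))[W1].
by rewrite lY1 => -[->].
Qed.

(** At the union of the critical set with [Z] both limits take the same critical value, and the
    bonding map carries this down to [Z]. *)
Lemma gamma_lim_crit_eq l l' X X' (Y : crit_in X) (Y' : crit_in X') :
  l X = GCrit Y -> l' X' = GCrit Y' -> crit_set Y = crit_set Y' -> l = l'.
Proof.
move=> lY lY' YY'; apply: invlim_ext => Z.
have h : (Z `<=` crit_set Y `|` Z)%fset by exact: fsubsetUr.
have YT : (crit_set Y `<=` crit_set Y `|` Z)%fset by exact: fsubsetUl.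
have YT' : (crit_set Y' `<=` crit_set Y `|` Z)%fset by rewrite -YY'.
rewrite -(lim_coordP l h) -(lim_coordP l' h).
rewrite (gamma_lim_crit YT lY) (gamma_lim_crit YT' lY').
by congr (bond _ _); congr GCrit; exact: crit_inj.
Qed.

End CriticalLimits.

(** * Tangles with the same critical set *)

Section Twins.
Context {G : graph}.
Implicit Types (X Y Z : {fset G}) (t : tangle G).
Notation US := (ultra_system (G := G)).
Let uC := ultra_Csystem G.

Definition tangle_gamma t : invlim (gamma_system (G := G)) :=
  @invlim_map G gamma_system US (@to_gamma G US uC) (to_gamma_bond uC) (tangle_lim t).

Lemma tangle_gamma_comp t X C :
  tangle_gamma t X = GComp C <-> tangle_lim t X = ultra_principal C.
Proof.
rewrite /tangle_gamma /=; split=> [E|->]; last exact: (to_gamma_ext uC).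
by have := to_gammaP uC (tangle_lim t X); rewrite E.
Qed.

(** An ultrafilter is either free or principal, and [to_gamma] sends exactly the principal ones to
    components. *)
Lemma free_at_crit t X : free_at t X <-> exists Y : crit_in X, tangle_gamma t X = GCrit Y.
Proof.
have UU := tangle_ultra_ultra t X.
case E : (tangle_gamma t X) => [C|Y].
  split=> [|[Y //]]; move/tangle_gamma_comp: E => E.
  have tE (P : set (component X)) : tangle_ultra t P <-> P C.
    by have := congr1 (fun u => ultra_filter u P) E => /= ->; exact: ultra_principalE.
  rewrite /free_at => F0.
  have : (\bigcap_(P in @tangle_ultra G t X) P) C by move=> P /tE.
  by rewrite F0.
split=> [_|_]; first by exists Y.
rewrite /free_at -subset0 => C CP.
suff /tangle_gamma_comp : tangle_lim t X = ultra_principal C by rewrite E.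
apply: ultra_inj; apply/esym; apply: (@max_filter _ (@tangle_ultra G t X) _).
by move=> P tP; apply/ultra_principalE; exact: CP.
Qed.

(** The critical value persists at every finite set containing the critical set, and any critical
    value elsewhere is the same set. So the default of [xget] does not occur. *)
Lemma least_free_crit t X (Y : crit_in X) : tangle_gamma t X = GCrit Y ->
  least_free t = crit_set Y.
Proof.
move=> tY.
have Yfree : free_at t (crit_set Y).
  apply/free_at_crit; eexists.
  exact: (gamma_lim_crit (fsubset_refl (crit_set Y)) tY).
have Yleast Z : free_at t Z -> (crit_set Y `<=` Z)%fset.
  by move=> /free_at_crit[W tW]; rewrite -(gamma_lim_crit_sub tY tW) crit_sub.
rewrite /least_free; case: xgetP => [Z _ [Zfree Zleast]|/(_ (crit_set Y))]; last by case.
by apply/eqP; rewrite eqEfsubset Zleast //= Yleast.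
Qed.

Lemma crit_not_end t X (Y : crit_in X) : tangle_gamma t X = GCrit Y -> not_end t.
Proof.
move=> tY w tw; suff /tangle_gamma_comp : tangle_lim t X = ultra_principal (end_comp X w).
  by rewrite tY.
by rewrite tw tangle_lim_end.
Qed.

(** Otherwise all ultrafilters of [t] are principal; their components are compatible, so they are
    those of an end, and [t] would be its tangle. *)
Lemma not_end_crit t : not_end t -> exists X (Y : crit_in X), tangle_gamma t X = GCrit Y.
Proof.
move=> nt; apply: contrapT => nY.
have cE X : exists C : component X, tangle_lim t X = ultra_principal C.
  case E : (tangle_gamma t X) => [C|Y]; first by exists C; exact/tangle_gamma_comp.
  by case: nY; exists X, Y.
pose c X := sval (cid (cE X)).
have cP X : tangle_lim t X = ultra_principal (c X) by rewrite /c; case: cid.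
have cB X' X (h : (X `<=` X')%fset) : comp_map h (c X') = c X.
  apply: (embed_inj (uC.1 X).2).
  by rewrite -(bond_map US h); have := lim_coordP (tangle_lim t) h; rewrite !cP.
have [w wc] := direction_end cB.
apply: (nt w); apply: tangle_lim_inj; rewrite tangle_lim_end.
by apply: invlim_ext => X; rewrite cP /= wc.
Qed.

Lemma tangle_gamma_eq t t' :
  tangle_gamma t = tangle_gamma t' <-> t = t' \/ tangle_twin t t'.
Proof.
split=> [E|[->//|[nt nt']]]; last first.
  have [X [Y tY]] := not_end_crit nt; have [X' [Y' tY']] := not_end_crit nt'.
  rewrite (least_free_crit tY) (least_free_crit tY').
  exact: gamma_lim_crit_eq.
have [[X [Y tY]]|nY] := pselect (exists X (Y : crit_in X), tangle_gamma t X = GCrit Y).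
  right; have tY' : tangle_gamma t' X = GCrit Y by rewrite -E.
  split; [exact: crit_not_end tY|exact: crit_not_end tY'|].
  by rewrite (least_free_crit tY) (least_free_crit tY').
left; apply: tangle_lim_inj; apply: invlim_ext => X.
case tX : (tangle_gamma t X) => [C|Y]; last by case: nY; exists X, Y.
have tX' : tangle_gamma t' X = GComp C by rewrite -E.
by move/tangle_gamma_comp: tX => ->; move/tangle_gamma_comp: tX' => ->.
Qed.

End Twins.

(** The relation [twin] is the fibre relation of the composite quotient map from the tangle space
    onto the space of critical sets. *)
Lemma twin_quotient (R : realType) (G : graph) :
  top_equiv (gamma_space R G) (quot_ext (twin_equiv R G)).
Proof.
pose uC := ultra_Csystem G.
pose f := @induced_map R G gamma_system ultra_system (@to_gamma G _ uC) (to_gamma_bond uC)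
  \o tangle_to_induced (R := R) (G := G).
have fm : ext_morphism f.
  apply: ext_morphism_comp; first exact: tangle_to_induced_morphism.
  apply: induced_map_morphism; exact: to_gamma_morphism.
apply: (quotient_top_equiv fm).
  apply: quotient_map_comp.
    exact/homeomorphism_quotient_map/tangle_to_induced_homeo.
  apply: induced_map_quotient => //; [exact: gamma_Csystem|exact: to_gamma_morphism].
have fE t : f (Lim t) = Lim (tangle_gamma t) by [].
move=> x y; apply/asboolP/eqP => [[->//|[t [t' [-> -> tt']]]]|].
  by rewrite !fE; congr Lim; apply/tangle_gamma_eq; right.
case: x y => [p|t] [q|t'] //; first by case=> ->; left.
rewrite !fE => /Lim_inj/tangle_gamma_eq[->|tt']; first by left.
by right; exists t, t'.
Qed.

Theorem theorem7p7 (R : realType) (G : graph) :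
  (is_Csystem (gamma_system (G := G)) /\
     forall a : comp_system G, is_Csystem a -> Cle gamma_system a) /\
  (is_Csystem (ultra_system (G := G)) /\
     forall a : comp_system G, is_Csystem a -> Cle a ultra_system) /\
  (is_Ccompactification (gamma_space R G) /\
     forall K : extension (ends_space R G), is_Ccompactification K ->
       coarser (gamma_space R G) K) /\
  (is_Ccompactification (tangle_space R G) /\
     forall K : extension (ends_space R G), is_Ccompactification K ->
       coarser K (tangle_space R G)) /\
  (forall K : extension (ends_space R G), is_Ccompactification K ->
     is_quotient (gamma_space R G) K /\ is_quotient K (tangle_space R G)) /\
  top_equiv (gamma_space R G) (quot_ext (twin_equiv R G)).
Proof.
have gC := @gamma_Csystem G; have uC := ultra_Csystem G.
have below K : is_Ccompactification K ->
    exists2 f : K -> gamma_space R G, ext_morphism f & quotient_map f.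
  move=> [_ [a aC Ka]].
  exact: (Cle_quotient_map gC aC (Cle_gamma aC) (top_equiv_refl _) Ka).
have above K : is_Ccompactification K ->
    exists2 f : tangle_space R G -> K, ext_morphism f & quotient_map f.
  move=> [_ [a aC Ka]].
  exact: (Cle_quotient_map aC uC (Cle_ultra aC) Ka (top_equiv_tangle_induced R)).
split; first by split=> // a; exact: Cle_gamma.
split; first by split=> // a; exact: Cle_ultra.
split.
  split; first exact: induced_Ccompactification.
  by move=> K /below[f fm _]; exists f.
split.
  split; first exact: tangle_Ccompactification.
  by move=> K /above[f fm _]; exists f.
split; last exact: twin_quotient.
move=> K KC; have [f fm fq] := below K KC; have [g gm gq] := above K KC.
by split; [exact: quotient_map_is_quotient fm fq|exact: quotient_map_is_quotient gm gq].
Qed.
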